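(* Let $G(s)$ be a square real-rational transfer function matrix (not necessarily proper). Suppose $G(s)$ has no poles at zero. Then $G(s)$ is lossless negative imaginary if and only if (1) $G(0)=G^{T}(0)$; and (2) $F(s)=-\frac{1}{s}[G(s)-G(0)]$ is lossless positive real.
   Context: $A^{T}$ and $A^{*}$ denote the transpose and complex conjugate transpose of a matrix. A square transfer function matrix $F(s)$ is positive real if: all elements of $F(s)$ are analytic in $\mathrm{Re}[s]>0$; $F(s)$ is real for real positive $s$; and $F^{*}(s)+F(s)\ge 0$ for $\mathrm{Re}[s]>0$. A square real-rational $F(s)$ is lossless positive real if it is positive real and $F(j\omega)+F^{*}(j\omega)=0$ for all $\omega>0$ except values of $\omega$ where $j\omega$ is a pole of $F(s)$. A square real-rational transfer function matrix $G(s)$ (a square matrix of rational functions with real coefficients) is negative imaginary if: (i) $G(s)$ has no poles in $\mathrm{Re}[s]>0$; (ii) $j[G(j\omega)-G^{*}(j\omega)]\ge 0$ for all $\omega>0$ except values of $\omega$ where $j\omega$ is a pole of $G(s)$; (iii) if $s=0$ is a pole of $G(s)$, then it is at most a double pole, $\lim_{s\to 0}s^{2}G(s)$ is positive semidefinite Hermitian, and $\lim_{s\to 0}s^{m}G(s)=0$ for all $m\ge 3$; (iv) if $s=j\omega_0$ with $\omega_0>0$ finite is a pole of $G(s)$, it is at most a simple pole and $K=\lim_{s\to j\omega_0}(s-j\omega_0)jG(s)$ is positive semidefinite Hermitian; (v) if $s=j\infty$ is a pole of $G(s)$, then it is at most a double pole, $\lim_{\omega\to\infty}G(j\omega)/(j\omega)^2$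 is negative semidefinite Hermitian, and $\lim_{\omega\to\infty}G(j\omega)/(j\omega)^m=0$ for all $m\ge 3$. A square real-rational $G(s)$ is lossless negative imaginary if it is negative imaginary and $j[G(j\omega)-G^{*}(j\omega)]=0$ for all $\omega>0$ except values of $\omega$ where $j\omega$ is a pole of $G(s)$. *)

(* Defs.v *)
From HB Require Import structures.
From mathcomp Require Import all_boot all_order all_algebra.
From mathcomp Require Import generic_quotient fraction complex.
From mathcomp Require Import all_classical all_reals all_analysis.

Set Implicit Arguments.
Unset Strict Implicit.
Unset Printing Implicit Defensive.

Import Order.TTheory GRing.Theory Num.Theory.
Import numFieldTopology.Exports numFieldNormedType.Exports.

Local Open Scope classical_set_scope.
Local Open Scope ring_scope.
Local Open Scope sesquilinear_scope.

(* Typing the complex numbers as a [numClosedFieldType] gives them the metric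
   topology which MathComp-Analysis provides for such fields; [R[i]] itself has
   no canonical topology. *)
Definition Cplx (R : realType) : numClosedFieldType := R[i].

Definition toC (R : realType) : R -> Cplx R := real_complex R.

HB.instance Definition _ (R : realType) :=
  GRing.RMorphism.copy (@toC R) (real_complex R).

Section RationalFunctions.
Variable R : realType.
Implicit Types (f : {fraction {poly R}}) (z : Cplx R) (x : R).

Definition imag_axis x : Cplx R := 'i * toC x.

(* [repr f] is an arbitrary, possibly non-reduced representative of [f];
   dividing by the gcd yields a fraction in lowest terms, so that the poles of
   [f] are exactly the roots of [rat_den f]. *)
Definition rat_num f : {poly R} :=
  let: r := repr f in (frac r).1 %/ gcdp (frac r).1 (frac r).2.

Definition rat_den f : {poly R} :=
  let: r := repr f in (frac r).2 %/ gcdp (frac r).1 (frac r).2.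

(* At a pole these two functions return the meaningless value 0. *)
Definition rat_eval f z : Cplx R :=
  (map_poly (@toC R) (rat_num f)).[z] / (map_poly (@toC R) (rat_den f)).[z].

Definition rat_evalR f x : R := (rat_num f).[x] / (rat_den f).[x].

Definition rat_pole_order f z : nat := mup z (map_poly (@toC R) (rat_den f)).

(* The degree excess of the numerator over the denominator (truncated
   subtraction), i.e. the order of the pole at 0 of [f(1/s)]. *)
Definition rat_pole_order_infty f : nat :=
  (size (rat_num f) - size (rat_den f))%N.

End RationalFunctions.

Section TransferMatrices.
Variables (R : realType) (n : nat).

Definition tfmx := 'M[{fraction {poly R}}]_n.

Implicit Types (G F : tfmx) (z : Cplx R) (x : R).

Definition tf_eval G z : 'M[Cplx R]_n := map_mx (fun f => rat_eval f z) G.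

Definition tf_evalR G x : 'M[R]_n := map_mx (fun f => rat_evalR f x) G.

Definition tf_const (A : 'M[R]_n) : tfmx :=
  map_mx (fun a => FracField.tofrac (a%:P)) A.

Definition tf_var : {fraction {poly R}} := FracField.tofrac 'X.

Definition tf_pole_order G z : nat :=
  (\max_i \max_j rat_pole_order (G i j) z)%N.

Definition tf_pole_order_infty G : nat :=
  (\max_i \max_j rat_pole_order_infty (G i j))%N.

Definition tf_pole G z : bool := (0 < tf_pole_order G z)%N.

Definition tf_pole_infty G : bool := (0 < tf_pole_order_infty G)%N.

(* [0 <= z] in [Cplx R] means that [z] is real and nonnegative. *)
Definition psdmx (M : 'M[Cplx R]_n) : Prop :=
  M \is hermsymmx /\ forall v : 'cV[Cplx R]_n, 0 <= (v ^t* *m M *m v) 0 0.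

Definition nsdmx (M : 'M[Cplx R]_n) : Prop := psdmx (- M).

(* A function on the open right half-plane is analytic iff it is complex
   differentiable at each of its points. For a rational function this excludes
   poles there, since the conventional value 0 at a pole makes it
   discontinuous. *)
Definition positive_real (F : Cplx R -> 'M[Cplx R]_n) : Prop :=
  [/\ forall i j z, 0 < 'Re z -> derivable (fun s => F s i j) z 1,
      forall x, 0 < x -> forall i j, F (toC x) i j \is Num.real
    & forall z, 0 < 'Re z -> psdmx ((F z) ^t* + F z)].

Definition lossless_positive_real F : Prop :=
  positive_real (tf_eval F) /\
  forall w : R, 0 < w -> ~~ tf_pole F (imag_axis w) ->
    tf_eval F (imag_axis w) + (tf_eval F (imag_axis w)) ^t* = 0.

Definition ni_form G (w : R) : 'M[Cplx R]_n :=
  'i *: (tf_eval G (imag_axis w) - (tf_eval G (imag_axis w)) ^t* ).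

Record negative_imaginary G : Prop := NegativeImaginary {
  ni_rhp : forall z, 0 < 'Re z -> ~~ tf_pole G z;
  ni_axis : forall w : R, 0 < w -> ~~ tf_pole G (imag_axis w) ->
    psdmx (ni_form G w);
  ni_zero : tf_pole G 0 ->
    [/\ (tf_pole_order G 0%R <= 2)%N,
        exists2 K : 'M[Cplx R]_n,
          (s ^+ 2 *: tf_eval G s @[s --> (0 : Cplx R)^'] --> K) & psdmx K
      & forall m : nat, (3 <= m)%N ->
          (s ^+ m *: tf_eval G s @[s --> (0 : Cplx R)^'] --> (0 : 'M[Cplx R]_n))];
  ni_imag : forall w : R, 0 < w -> tf_pole G (imag_axis w) ->
    (tf_pole_order G (imag_axis w) <= 1)%N /\
    exists2 K : 'M[Cplx R]_n,
      (((s - imag_axis w) * 'i) *: tf_eval G s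
         @[s --> (imag_axis w)^'] --> K)
      & psdmx K;
  ni_infty : tf_pole_infty G ->
    [/\ (tf_pole_order_infty G <= 2)%N,
        exists2 K : 'M[Cplx R]_n,
          ((imag_axis w ^+ 2)^-1 *: tf_eval G (imag_axis w)
             @[w --> +oo] --> K)
          & nsdmx K
      & forall m : nat, (3 <= m)%N ->
          ((imag_axis w ^+ m)^-1 *: tf_eval G (imag_axis w)
             @[w --> +oo] --> (0 : 'M[Cplx R]_n))]
}.

Definition lossless_negative_imaginary G : Prop :=
  negative_imaginary G /\
  forall w : R, 0 < w -> ~~ tf_pole G (imag_axis w) -> ni_form G w = 0.

End TransferMatrices.

Lemma tf_eval_toC (R : realType) (n : nat) (G : tfmx R n) (x : R) :
  tf_eval G (toC x) = map_mx (@toC R) (tf_evalR G x).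
Proof.
by apply/matrixP => i j; rewrite !mxE /rat_eval /rat_evalR !horner_map -fmorph_div.
Qed.

(* Main.v *)
Require Import Defs.
From mathcomp Require Import all_boot all_order all_algebra.
From mathcomp Require Import generic_quotient fraction.
From mathcomp Require Import all_classical all_reals all_analysis.
From mathcomp Require Import ring.
From mathcomp Require complex.

Set Implicit Arguments.
Unset Strict Implicit.
Unset Printing Implicit Defensive.

Import Order.TTheory GRing.Theory Num.Theory.
Import numFieldTopology.Exports numFieldNormedType.Exports.

Local Open Scope classical_set_scope.
Local Open Scope ring_scope.
Local Open Scope sesquilinear_scope.

(* F = -(G - G(0))/s is a complex rational matrix, studied through the scalar
   functions f = v^* F v.

   If G is lossless negative imaginary, f has no pole in Re s > 0 and
   f(s) + conj f(- conj s) = 0 holds identically, so all its poles lie on the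
   imaginary axis. The conditions on G at its poles, transported to F, say that
   these poles are simple with nonnegative residues, and that f(s)/s has a
   nonnegative limit at infinity. Hence
     f(s) = q s + b + sum_k c_k / (s - a_k)
   with q, c_k >= 0 and a_k, b purely imaginary, so that Re f >= 0 in Re s > 0.

   Conversely, let Re f >= 0 in Re s > 0, and let c be the leading coefficient
   of f at a pole of order m on the imaginary axis. Approaching the pole along
   the ray of direction u gives Re (c / u^m) >= 0 for all u with Re u >= 0. When
   m >= 2 the power u^m takes the value -c, so c = 0; when m = 1 taking
   u = 1, i, -i gives c >= 0. The substitution s = 1/z treats infinity in the
   same way. *)

(** * Limits of scalar, polynomial and matrix functions *)

Section Limits.
Variable K : numFieldType.

Lemma cvg_dnbhs (T : Type) (F : set_system T) {FF : Filter F}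
    (f : T -> K) (a : K) :
  f x @[x --> F] --> a -> (\forall x \near F, f x != a) ->
  f x @[x --> F] --> a^'.
Proof.
move=> fa fna A; rewrite /dnbhs /within /= => nA.
by apply: filterS2 fna (fa _ nA) => x /= fxa; apply.
Qed.

Lemma cvgr_ext (T : Type) (F : set_system T) (f g : T -> K) (a : K) :
  f =1 g -> g x @[x --> F] --> a -> f x @[x --> F] --> a.
Proof. by move=> /funext ->. Qed.

Lemma cvgr_unique (T : Type) (F : set_system T) {FF : ProperFilter F}
    (f : T -> K) (a b : K) :
  f x @[x --> F] --> a -> f x @[x --> F] --> b -> a = b.
Proof. by move=> fa fb; exact: (@norm_cvg_unique K K^o _ _ a b fa fb). Qed.

Lemma near_cvgr (T : Type) (F : set_system T) {FF : Filter F}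
    (f g : T -> K) (a : K) :
  (\forall x \near F, g x = f x) ->
  g x @[x --> F] --> a -> f x @[x --> F] --> a.
Proof.
by move=> fg ga; apply: cvg_trans ga; apply: near_eq_cvg; exact: fg.
Qed.

Lemma cvg_horner (T : Type) (F : set_system T) {FF : Filter F} (f : T -> K)
    (p : {poly K}) (a : K) :
  f x @[x --> F] --> a -> p.[f x] @[x --> F] --> p.[a].
Proof.
move=> fa; elim/poly_ind: p => [|p r ih].
  by rewrite horner0; apply: (cvgr_ext (fun x => horner0 (f x)));
    exact: cvg_cst.
rewrite hornerMXaddC; apply: (cvgr_ext (fun x => hornerMXaddC p r (f x))).
by apply: cvgD; [exact: cvgM | exact: cvg_cst].
Qed.

Lemma cvg_id_dnbhs (a : K) : x @[x --> a^'] --> a.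
Proof. exact: nbhs_dnbhs. Qed.

Lemma cvg_horner_dnbhs (p : {poly K}) (a : K) : p.[x] @[x --> a^'] --> p.[a].
Proof. by apply: cvg_horner; exact: cvg_id_dnbhs. Qed.

(** Split off the full power of ['X - a%:P]: the power is nonzero away from [a], and the cofactor
    near [a] by continuity. *)
Lemma near_dnbhs_horner_neq0 (p : {poly K}) (a : K) :
  p != 0 -> \forall x \near a^', p.[x] != 0.
Proof.
move=> p0; have [n [q]] := multiplicity_XsubC p a.
rewrite p0 /= => qa ->.
near=> x; rewrite hornerM mulf_neq0 //; last first.
  rewrite horner_exp !hornerE expf_neq0 // subr_eq0.
  by near: x; exact: nbhs_dnbhs_neq.
near: x; apply: (@cvgr_neq0 _ _ _ _ _ (horner q) q.[a]) => //.
exact: cvg_horner_dnbhs.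
Unshelve. all: by end_near. Qed.

Lemma near_neq0 (a : K) : \forall x \near a^', x != 0.
Proof.
have := near_dnbhs_horner_neq0 a (negbT (polyX_eq0 K)).
by apply: filterS => x; rewrite hornerX.
Qed.

Lemma cvg_subr_dnbhs (a : K) : x - a @[x --> a^'] --> (0 : K).
Proof.
by rewrite -(subrr a); apply: cvgB; [exact: cvg_id_dnbhs | exact: cvg_cst].
Qed.

Lemma cvg_addl_dnbhs (a : K) : a + z @[z --> (0 : K)^'] --> a^'.
Proof.
apply: cvg_dnbhs.
  rewrite -[X in _ --> X]addr0.
  by apply: cvgD; [exact: cvg_cst | exact: cvg_id_dnbhs].
apply: filterS (nbhs_dnbhs_neq (0 : K)) => z z0.
by rewrite -subr_eq0 addrC addKr.
Qed.

Lemma cvgrX (T : Type) (F : set_system T) {FF : Filter F}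
    (f : T -> K) (a : K) (k : nat) :
  f x @[x --> F] --> a -> (f x) ^+ k @[x --> F] --> a ^+ k.
Proof.
move=> fa; elim: k => [|k ih].
  by apply: (cvgr_ext (fun x => expr0 (f x))); exact: cvg_cst.
by rewrite exprS; apply: (cvgr_ext (fun x => exprS (f x) k)); exact: cvgM.
Qed.

Lemma cvgr_sum (T : Type) (I : Type) (r : seq I) (F : set_system T) {FF : Filter F}
    (f : I -> T -> K) (a : I -> K) :
  (forall i, f i x @[x --> F] --> a i) ->
  \sum_(i <- r) f i x @[x --> F] --> \sum_(i <- r) a i.
Proof.
move=> fa; elim: r => [|i r ih].
  rewrite big_nil; apply: (@cvgr_ext _ _ _ (fun=> 0)) => [x|].
    by rewrite big_nil.
  exact: cvg_cst.
rewrite big_cons.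
apply: (@cvgr_ext _ _ _ (fun x => f i x + \sum_(j <- r) f j x)) => [x|].
  by rewrite big_cons.
by apply: cvgD; [exact: fa | exact: ih].
Qed.

(** The reverse direction needs all entries to be close at once, which the filter grants because
    there are finitely many index pairs. *)
Lemma cvg_mxP (T : Type) (F : set_system T) {FF : Filter F} (m n : nat)
    (f : T -> 'M[K]_(m, n)) (M : 'M[K]_(m, n)) :
  f x @[x --> F] --> M <-> forall i j, f x i j @[x --> F] --> M i j.
Proof.
split=> [fM i j|fM].
  apply: (cvg_comp f (fun N : 'M[K]_(m, n) => N i j) fM).
  exact: coord_continuous.
apply/cvg_mx_entourageP => A entA.
have H : \forall x \near F, forall ij : 'I_m * 'I_n,
    A (M ij.1 ij.2, f x ij.1 ij.2).
  apply: filter_forall => -[i j] /=.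
  by have /cvg_entourageP/(_ A entA) := fM i j.
by apply: filterS H => x H i j; rewrite inE; exact: (H (i, j)).
Qed.

End Limits.

(** * Complex limits and the sector argument at a boundary point *)

Section ComplexLimits.
Variable C : numClosedFieldType.

(** If ['Re c] were negative, points within [- 'Re c] of [c] would have negative real part. *)
Lemma cvg_Re_ge0 (T : Type) (F : set_system T) {FF : ProperFilter F}
    (f : T -> C) (c : C) :
  f x @[x --> F] --> c ->
  (\forall x \near F, 0 <= 'Re (f x)) -> 0 <= 'Re c.
Proof.
move=> fc fge; rewrite real_leNgt ?Creal_Re //; apply/negP => c0.
have /cvgrPdist_lt /(_ (- 'Re c)) := fc.
rewrite oppr_gt0 => /(_ c0) fc'.
have [x [dx rx]] := filter_ex (filterI fc' fge).
have := le_lt_trans (leif_normC_Re_Creal (c - f x)) dx.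
rewrite raddfB -normrN opprB => /(le_lt_trans (real_ler_norm _)).
rewrite rpredB ?Creal_Re // => /(_ isT).
by rewrite -subr_lt0 opprK subrK => /(le_lt_trans rx); rewrite ltxx.
Qed.

Lemma cvgr_conj (T : Type) (F : set_system T) {FF : Filter F}
    (f : T -> C) (c : C) :
  f x @[x --> F] --> c -> (f x)^* @[x --> F] --> c^*.
Proof.
move=> /cvgrPdist_lt fc; apply/cvgrPdist_lt => e e0.
by apply: filterS (fc e e0) => x; rewrite -rmorphB norm_conjC.
Qed.

Lemma cvg_conj_dnbhs (a : C) : s^* @[s --> a^'] --> (a^*)^'.
Proof.
apply: cvg_dnbhs; first by apply: cvgr_conj; exact: cvg_id_dnbhs.
apply: filterS (nbhs_dnbhs_neq a) => s.
by apply: contra => /eqP/(can_inj conjCK) ->.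
Qed.

(** In the partial order of [C], [0 < t] forces [t] to be real, so this path runs down the positive
    imaginary axis to the origin. *)
Lemma cvg_imul_at_right : 'i * t @[t --> (0 : C)^'+] --> (0 : C)^'.
Proof.
apply: cvg_dnbhs.
  rewrite -[X in _ --> X](mulr0 'i); apply: cvgM; first exact: cvg_cst.
  exact: cvg_at_right_filter cvg_id.
apply: filterS (nbhs_right_gt 0) => t t0.
by rewrite mulf_neq0 ?neq0Ci // lt0r_neq0.
Qed.

Lemma near_imul_at_right (P : C -> Prop) :
  (\forall s \near (0 : C)^', P s) -> \forall t \near (0 : C)^'+, P ('i * t).
Proof. by move=> nP; exact: (cvg_imul_at_right nP). Qed.

(* For m > 1 the m-th roots of a sum to 0, so they cannot all lie in the open
   left half-plane. *)
Lemma rootC_Re_ge0 (m : nat) (a : C) :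
  (1 < m)%N -> exists2 u : C, u ^+ m = a & 0 <= 'Re u.
Proof.
move=> m1; have m0 : (0 < m)%N by exact: ltnW.
have [r] := closed_field_poly_normal ('X^m - a%:P : {poly C}).
rewrite (monicP (monicXnsubC _ m0)) scale1r => rE.
have sr : size r = m.
  by have := congr1 (fun p : {poly C} => size p) rE;
    rewrite size_XnsubC // size_prod_XsubC => -[].
have sum0 : \sum_(z <- r) z = 0.
  apply/eqP; rewrite -oppr_eq0 -coefPn_prod_XsubC sr -?lt0n // -rE.
  rewrite coefB coefXn coefC; case: (m) m1 => [|[|k]] //= _.
  by rewrite ltn_eqF // subrr.
have [u ur /= ru] : exists2 u, u \in r & 0 <= 'Re u.
  apply/hasP; apply/negPn/negP => /hasPn H.
  have : 'Re (\sum_(z <- r) z) < 0.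
    rewrite raddf_sum /= big_seq -oppr_gt0 -sumrN.
    case: r sr H {rE sum0} => [|z r sr H]; first by move=> s0; rewrite -s0 in m0.
    rewrite -big_seq big_cons ltr_wpDr //.
      rewrite big_seq sumr_ge0 // => i ir.
      have := H i; rewrite inE ir orbT => /(_ isT).
      by rewrite -real_ltNge ?Creal_Re // oppr_ge0 => /ltW.
    have := H z; rewrite inE eqxx => /(_ isT).
    by rewrite -real_ltNge ?Creal_Re // oppr_gt0.
  by rewrite sum0 raddf0 ltxx.
exists u => //; apply/eqP; rewrite -subr_eq0.
have : root ('X^m - a%:P) u by rewrite rE root_prod_XsubC.
by rewrite /root !hornerE.
Qed.

(* The path t (u + t), t > 0, tends to 0 inside the open right half-plane even
   when u lies on the imaginary axis. *)
Lemma cvg_Re_sector (g : C -> C) (m : nat) (c u : C) :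
  g z @[z --> (0 : C)^'] --> c ->
  (forall z, 0 < 'Re z -> 0 <= 'Re (g z / z ^+ m)) ->
  u != 0 -> 0 <= 'Re u -> 0 <= 'Re (c / u ^+ m).
Proof.
move=> gc gge u0 ru.
have tu : u + t @[t --> (0 : C)^'+] --> u.
  rewrite -[X in _ --> X]addr0; apply: cvgD; first exact: cvg_cst.
  exact: cvg_at_right_filter cvg_id.
have uz : \forall t \near (0 : C)^'+, u + t != 0.
  by apply: (cvgr_neq0 _ tu).
have t0 : \forall t \near (0 : C)^'+, 0 < t by exact: nbhs_right_gt.
have gam : t * (u + t) @[t --> (0 : C)^'+] --> (0 : C)^'.
  apply: cvg_dnbhs.
    rewrite -[X in _ --> X](mul0r u); apply: cvgM => //.
    exact: cvg_at_right_filter cvg_id.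
  by apply: filterS2 uz t0 => t ut /lt0r_neq0 t0; rewrite mulf_neq0.
apply: (@cvg_Re_ge0 _ ((0 : C)^'+) _
  (fun t => g (t * (u + t)) / (u + t) ^+ m)).
  apply: cvgM; first exact: (cvg_comp _ _ gam gc).
  by apply: cvgV; [rewrite expf_neq0 | exact: cvgrX].
apply: filterS2 uz t0 => t ut t0.
have tr : t \is Num.real by exact: gtr0_real.
have := gge (t * (u + t)).
rewrite ReMl // raddfD /= (Creal_ReP _ tr) mulr_gt0 ?ltr_wpDl // => /(_ isT).
rewrite exprMn invfM mulrCA.
have tmr : t ^- m \is Num.real by rewrite rpredV rpredX.
by rewrite (ReMl tmr) pmulr_rge0 // invr_gt0 exprn_gt0.
Qed.

Lemma sector_simple_ge0 (g : C -> C) (c : C) :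
  g z @[z --> (0 : C)^'] --> c ->
  (forall z, 0 < 'Re z -> 0 <= 'Re (g z / z)) -> 0 <= c.
Proof.
move=> gc gge.
have H u : u != 0 -> 0 <= 'Re u -> 0 <= 'Re (c / u).
  by move=> u0 ru; have := @cvg_Re_sector g 1 c u gc gge u0 ru; rewrite expr1.
have c1 := H 1 (oner_neq0 _).
rewrite (Creal_ReP _ (rpred1 _)) divr1 in c1.
(* The real parts of [c / 'i] and [c / - 'i] are ['Im c] and [- 'Im c], so the two directions
   together make [c] real. *)
have := H 'i (neq0Ci _); rewrite Re_i lexx => /(_ isT).
rewrite invCi mulrN raddfN /= ReMir opprK => im0.
have := H (- 'i); rewrite oppr_eq0 neq0Ci raddfN /= Re_i oppr0 lexx.
move=> /(_ isT isT); rewrite invrN invCi opprK ReMir oppr_ge0 => im1.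
have im : 'Im c = 0 by apply/eqP; rewrite eq_le im0 im1.
by rewrite [c]Crect im mulr0 addr0 c1.
Qed.

Lemma sector_multiple_eq0 (g : C -> C) (m : nat) (c : C) :
  (1 < m)%N -> g z @[z --> (0 : C)^'] --> c ->
  (forall z, 0 < 'Re z -> 0 <= 'Re (g z / z ^+ m)) -> c = 0.
Proof.
move=> m1 gc gge; apply/eqP; apply/negPn/negP => c0.
have [u um ru] := rootC_Re_ge0 (- c) m1.
have u0 : u != 0.
  apply: contraNneq c0 => u0; rewrite -oppr_eq0 -um u0 expr0n.
  by case: m m1 {gge um}.
have := cvg_Re_sector gc gge u0 ru.
rewrite um invrN mulrN divff // raddfN /= (Creal_ReP _ (rpred1 _)).
by rewrite oppr_ge0 ler10.
Qed.

End ComplexLimits.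

(** * Pole orders of rational functions as limits, at finite points and at infinity *)

Section RationalLimits.
Variable C : numClosedFieldType.
Implicit Types (p N D : {poly C}) (a c z : C).

(** If [('X - a%:P) ^+ k.+1] divided [D], multiplying the limit by the cofactor would make [N]
    vanish at [a], a root of [D], against coprimality. A limit 0, rather than mere convergence, is
    what lowers the bound by one. *)
Lemma cvg0_mup_leq N D (a : C) (k : nat) :
  D != 0 -> coprimep N D ->
  (s - a) ^+ k.+1 * (N.[s] / D.[s]) @[s --> a^'] --> (0 : C) ->
  (mup a D <= k)%N.
Proof.
move=> D0 cND lim; rewrite mup_leq //; apply/negP => /dvdpP[E DE].
have Da : root D a.
  by rewrite DE rootM root_exp_XsubC eqxx orbT.
have := coprimep_root (etrans (coprimep_sym _ _) cND) Da.
move=> /eqP; apply.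
apply: (cvgr_unique (@cvg_horner_dnbhs _ N a)).
have near_eq : \forall s \near a^',
    (s - a) ^+ k.+1 * (N.[s] / D.[s]) * E.[s] = N.[s].
  apply: filterS (near_dnbhs_horner_neq0 a D0) => s Ds.
  move: Ds; rewrite DE !(hornerM, horner_exp, hornerXsubC) mulf_eq0 negb_or.
  by case/andP => Es sak; field; rewrite Es sak.
apply: (near_cvgr near_eq).
rewrite -[X in _ --> X](mul0r E.[a]); apply: cvgM => //.
exact: cvg_horner_dnbhs.
Qed.

(** One more factor [s - a] turns any finite limit into the limit 0. *)
Lemma cvg_mup_leq N D (a c : C) (k : nat) :
  D != 0 -> coprimep N D ->
  (s - a) ^+ k * (N.[s] / D.[s]) @[s --> a^'] --> c -> (mup a D <= k)%N.
Proof.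
move=> D0 cND lim; apply: (cvg0_mup_leq D0 cND).
apply: (@cvgr_ext _ _ _ _ (fun s => (s - a) * ((s - a) ^+ k * (N.[s] / D.[s])))).
  by move=> s; rewrite exprS mulrA.
rewrite -[X in _ --> X](mul0r c); apply: cvgM => //.
exact: cvg_subr_dnbhs.
Qed.

Lemma mup_leq_cvg N D (a : C) (k : nat) : D != 0 -> (mup a D <= k)%N ->
  exists c, (s - a) ^+ k * (N.[s] / D.[s]) @[s --> a^'] --> c.
Proof.
move=> D0 mk; have [m [E]] := multiplicity_XsubC D a.
rewrite D0 /= => Ea DE.
have mE : mup a D = m by rewrite DE mupMr // mup_XsubCX eqxx.
rewrite mE in mk.
(* Cancelling the full power [(s - a) ^+ m] of [D] leaves [k - m] factors above the cofactor [E],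
   which does not vanish at [a]. *)
exists ((('X - a%:P) ^+ (k - m) * N).[a] / E.[a]).
have near_eq : \forall s \near a^',
    (('X - a%:P) ^+ (k - m) * N).[s] / E.[s] = (s - a) ^+ k * (N.[s] / D.[s]).
  apply: filterS (near_dnbhs_horner_neq0 a D0) => s Ds.
  move: Ds; rewrite DE !(hornerM, horner_exp, hornerXsubC) mulf_eq0 negb_or.
  case/andP => Es sa; have -> : (s - a) ^+ k = (s - a) ^+ (k - m) * (s - a) ^+ m.
    by rewrite -exprD subnK.
  move: sa; move: ((s - a) ^+ (k - m)) ((s - a) ^+ m) => x y y0; field.
  by rewrite Es y0.
apply: (near_cvgr near_eq).
apply: cvgM; first exact: cvg_horner_dnbhs.
by apply: cvgV; [exact: Ea | exact: cvg_horner_dnbhs].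
Qed.

(* z^n p(1/z), which turns limits at infinity into limits at 0. *)
Definition rev_poly (n : nat) p : {poly C} := \poly_(i < n.+1) p`_(n - i).

Lemma horner_rev_poly n p z : (size p <= n.+1)%N -> z != 0 ->
  (rev_poly n p).[z] = z ^+ n * p.[z^-1].
Proof.
move=> pn z0; rewrite horner_poly (horner_coef_wide _ pn) mulr_sumr.
rewrite (reindex_inj rev_ord_inj) /=; apply: eq_bigr => i _.
have lei : (i <= n)%N by rewrite -ltnS.
rewrite subSS (subKn lei) mulrCA; congr (_ * _).
by rewrite exprVn exprB ?unitfE.
Qed.

Lemma rev_poly0 n p : (rev_poly n p).[0] = p`_n.
Proof. by rewrite horner_coef0 coef_poly subn0. Qed.

Lemma rev_poly_lead_neq0 p : p != 0 -> (rev_poly (size p).-1 p).[0] != 0.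
Proof. by rewrite rev_poly0 -lead_coefE lead_coef_eq0. Qed.

Lemma near_infty_horner_neq0 p :
  p != 0 -> \forall z \near (0 : C)^', p.[z^-1] != 0.
Proof.
move=> p0; have r0 : rev_poly (size p).-1 p != 0.
  by apply: contraNneq (rev_poly_lead_neq0 p0) => ->; rewrite horner0.
apply: filterS2 (near_neq0 (0 : C)) (near_dnbhs_horner_neq0 0 r0) => z z0.
rewrite horner_rev_poly //; last by rewrite prednK // size_poly_gt0.
by rewrite mulf_eq0 negb_or => /andP[].
Qed.

(** Were the degree of [N] to exceed that of [D] by more than [k], the reversed numerator would be
    the given function times a polynomial and so tend to 0 at 0, while its value there is the
    leading coefficient of [N]. *)
Lemma cvg0_infty_size_leq N D (k : nat) : D != 0 ->
  z ^+ k.+1 * (N.[z^-1] / D.[z^-1]) @[z --> (0 : C)^'] --> (0 : C) ->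
  (size N <= size D + k)%N.
Proof.
move=> D0 lim; rewrite leqNgt; apply/negP => ltN.
have N0 : N != 0 by rewrite -size_poly_gt0; exact: leq_ltn_trans ltN.
set n := (size N).-1; set d := (size D).-1.
have dS : size D = d.+1 by rewrite prednK // size_poly_gt0.
have nS : size N = n.+1 by rewrite prednK // size_poly_gt0.
have nE : n = (k.+1 + d + (n - (k.+1 + d)))%N.
  by rewrite subnKC // -ltnS -nS addSnnS addnC -dS.
move/eqP: (rev_poly_lead_neq0 N0); apply.
apply: (cvgr_unique (@cvg_horner_dnbhs _ (rev_poly n N) 0)).
have near_eq : \forall z \near (0 : C)^',
    z ^+ k.+1 * (N.[z^-1] / D.[z^-1]) *
    ('X ^+ (n - (k.+1 + d)) * rev_poly d D).[z] = (rev_poly n N).[z].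
  apply: filterS2 (near_neq0 (0 : C)) (near_infty_horner_neq0 D0) => z z0 Dz.
  rewrite hornerM horner_exp !hornerX !horner_rev_poly ?dS ?nS //.
  rewrite [in RHS]nE !exprD; field; exact: Dz.
apply: (near_cvgr near_eq).
rewrite -[X in _ --> X](mul0r ('X ^+ (n - (k.+1 + d)) * rev_poly d D).[0]).
by apply: cvgM => //; exact: cvg_horner_dnbhs.
Qed.

Lemma cvg_infty_size_leq N D (c : C) (k : nat) : D != 0 ->
  z ^+ k * (N.[z^-1] / D.[z^-1]) @[z --> (0 : C)^'] --> c ->
  (size N <= size D + k)%N.
Proof.
move=> D0 lim; apply: (cvg0_infty_size_leq D0).
apply: (@cvgr_ext _ _ _ _ (fun z => z * (z ^+ k * (N.[z^-1] / D.[z^-1])))).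
  by move=> z; rewrite exprS mulrA.
rewrite -[X in _ --> X](mul0r c); apply: cvgM => //.
exact: cvg_id_dnbhs.
Qed.

(** The coefficient in the limit is 0 when the degree of [N] is below that of [D] plus [k], so
    slower and exact growth are covered together. *)
Lemma cvg_infty N D (k : nat) : D != 0 -> (size N <= size D + k)%N ->
  z ^+ k * (N.[z^-1] / D.[z^-1]) @[z --> (0 : C)^']
    --> N`_((size D).-1 + k) / lead_coef D.
Proof.
move=> D0 Nk; set d := (size D).-1.
have dS : size D = d.+1 by rewrite prednK // size_poly_gt0.
rewrite lead_coefE -!rev_poly0.
have near_eq : \forall z \near (0 : C)^',
    (rev_poly (d + k) N).[z] / (rev_poly d D).[z] =
    z ^+ k * (N.[z^-1] / D.[z^-1]).
  apply: filterS2 (near_neq0 (0 : C)) (near_infty_horner_neq0 D0) => z z0 Dz.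
  rewrite !horner_rev_poly ?dS -?addSn -?dS // exprD; field.
  by rewrite Dz expf_neq0.
apply: (near_cvgr near_eq).
apply: cvgM; first exact: cvg_horner_dnbhs.
by apply: cvgV; [exact: rev_poly_lead_neq0 | exact: cvg_horner_dnbhs].
Qed.

End RationalLimits.

(** * Fractions in lowest terms and their evaluation *)

Section Fractions.
Variable R : realType.
Local Notation C := (Cplx R).
Implicit Types (f g : {fraction {poly R}}) (z : C).

Definition numC f : {poly C} := map_poly (@toC R) (rat_num f).
Definition denC f : {poly C} := map_poly (@toC R) (rat_den f).

(** Dividing a representative by its gcd gives coprimality; the last component is checked on pairs,
    where equality in the quotient is cross multiplication. *)
Lemma rat_numden_spec f :
  [/\ rat_den f != 0, coprimep (rat_num f) (rat_den f) &
      f = FracField.tofrac (rat_num f) / FracField.tofrac (rat_den f)].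
Proof.
set r := repr f; set n := (frac r).1; set d := (frac r).2.
have d0 : d != 0 by exact: denom_ratioP.
have g0 : gcdp n d != 0 by rewrite gcdp_eq0 negb_and d0 orbT.
have nE : n = rat_num f * gcdp n d by rewrite divpK ?dvdp_gcdl.
have dE : d = rat_den f * gcdp n d by rewrite divpK ?dvdp_gcdr.
have den0 : rat_den f != 0.
  by apply: contraNneq d0 => den0; rewrite dE den0 mul0r.
split => //; first by rewrite coprimep_div_gcd // d0 orbT.
have -> : FracField.tofrac (rat_num f) / FracField.tofrac (rat_den f) =
    FracField.tofrac n / FracField.tofrac d.
  move: (gcdp n d) g0 nE dE => h h0 -> ->; rewrite !tofracM.
  by rewrite -mulf_div divff ?mulr1 // tofrac_eq0.
have td0 : FracField.tofrac d != 0 by rewrite tofrac_eq0.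
apply: (mulIf td0); rewrite divfK //.
rewrite -[f in LHS]reprK -/r; unlock FracField.tofrac.
rewrite -[LHS]FracField.pi_mul; apply/eqmodP => /=.
rewrite FracField.equivfE /FracField.mulf !numden_Ratio ?oner_eq0 ?mulr1 //.
by rewrite -/n -/d mulrC.
Qed.

Lemma denC_neq0 f : denC f != 0.
Proof. by rewrite map_poly_eq0; case: (rat_numden_spec f). Qed.

Lemma coprime_numC_denC f : coprimep (numC f) (denC f).
Proof. by rewrite coprimep_map; case: (rat_numden_spec f). Qed.

(** By coprimality the reduced denominator divides [q], so a fraction that is not in lowest terms
    still gives the value wherever its denominator is nonzero. *)
Lemma rat_eval_frac f (p q : {poly R}) z :
  f = FracField.tofrac p / FracField.tofrac q ->
  (map_poly (@toC R) q).[z] != 0 ->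
  (denC f).[z] != 0 /\
  rat_eval f z = (map_poly (@toC R) p).[z] / (map_poly (@toC R) q).[z].
Proof.
move=> fE qz; have [den0 cop fE'] := rat_numden_spec f.
have q0 : q != 0 by apply: contraNneq qz => ->; rewrite rmorph0 horner0.
have cross : rat_num f * q = rat_den f * p.
  apply/eqP; rewrite -tofrac_eq !tofracM.
  have tq0 : FracField.tofrac q != 0 by rewrite tofrac_eq0.
  have td0 : FracField.tofrac (rat_den f) != 0 by rewrite tofrac_eq0.
  have /eqP := etrans (esym fE) fE'; rewrite (eqr_div _ _ tq0 td0) => /eqP e.
  by rewrite -e; apply/eqP; exact: mulrC.
have den_dvd : rat_den f %| q.
  rewrite -(Gauss_dvdpr _ (etrans (coprimep_sym _ _) cop)) cross.
  exact: dvdp_mulIl.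
have denz : (denC f).[z] != 0.
  have [h hE] := dvdpP _ _ den_dvd.
  by move: qz; rewrite hE rmorphM hornerM mulf_eq0 negb_or => /andP[].
split => //; rewrite /rat_eval; apply/eqP; rewrite eqr_div //.
rewrite -!hornerM -!rmorphM cross.
by rewrite mulrC.
Qed.

End Fractions.

(** * Partial fractions and positivity of a scalar lossless function *)

Section Lossless.
Variable C : numClosedFieldType.
Implicit Types (p N D : {poly C}) (a c z s : C).

(** On the imaginary axis this polynomial takes the conjugate values of [p], so a conjugate identity
    on the axis can be stated as an identity of polynomials. *)
Definition para_conj p : {poly C} := map_poly Num.conj p \Po (- 'X).

Lemma horner_para_conj p z : (para_conj p).[z] = (p.[- z^*])^*.
Proof.
rewrite /para_conj horner_comp hornerN hornerX -[- z in LHS](@conjCK C).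
by rewrite horner_map rmorphN.
Qed.

Lemma para_conj_axis p z : 'Re z = 0 -> (para_conj p).[z] = (p.[z])^*.
Proof.
move=> z0; rewrite horner_para_conj; congr (_.[_]^*).
by move/eqP: z0; rewrite ReE mulf_eq0 invr_eq0 pnatr_eq0 orbF addr_eq0 => /eqP <-.
Qed.

Section PartialFractions.
Variables (N D : {poly C}) (rs : seq C).
Hypothesis DE : D = lead_coef D *: \prod_(a <- rs) ('X - a%:P).
Hypothesis rs_uniq : uniq rs.
Hypothesis D0 : D != 0.

Let E a := D %/ ('X - a%:P).

Lemma root_rs a : root D a = (a \in rs).
Proof. by rewrite DE rootZ ?lead_coef_eq0 // root_prod_XsubC. Qed.

Lemma cofactorE a : a \in rs -> D = E a * ('X - a%:P).
Proof. by rewrite -root_rs -dvdp_XsubCl => aD; rewrite /E divpK. Qed.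

Lemma size_D_rs : size D = (size rs).+1.
Proof. by rewrite DE size_scale ?lead_coef_eq0 // size_prod_XsubC. Qed.

Lemma mup_D a : a \in rs -> mup a D = 1%N.
Proof.
move=> ars; rewrite DE -mul_polyC mupMr.
  by rewrite mu_prod_XsubC count_uniq_mem // ars.
by rewrite rootC lead_coef_eq0.
Qed.

Lemma cofactor_neq0 a : a \in rs -> (E a).[a] != 0.
Proof.
move=> ars; apply/negP => /eqP/eqP Ea.
have : (1 < mup a D)%N.
  rewrite mup_geq // (cofactorE ars) exprS expr1.
  by rewrite dvdp_mul2r ?polyXsubC_eq0 // dvdp_XsubCl.
by rewrite mup_D.
Qed.

Lemma cofactor_eq0 a b : a \in rs -> b \in rs -> a != b -> (E a).[b] = 0.
Proof.
move=> ars brs ab; have := brs; rewrite -root_rs {1}(cofactorE ars).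
by rewrite rootM root_XsubC [b == a]eq_sym (negPf ab) orbF => /rootP.
Qed.

(** Lagrange interpolation: both sides have degree below the number of nodes in [rs] and agree at
    each node. *)
Lemma modp_partial_fractions :
  N %% D = \sum_(a <- rs) (N.[a] / (E a).[a]) *: E a.
Proof.
apply/eqP; rewrite -subr_eq0; apply/negPn/negP => P0.
set P := _ - _ in P0.
suff : (size rs < size P)%N.
  apply/negP; rewrite -leqNgt (leq_trans (size_polyD _ _)) // size_polyN geq_max.
  rewrite -ltnS -size_D_rs ltn_modp D0 /=.
  apply: leq_trans (size_sum _ _ _) _; apply/bigmax_leqP_seq => a ars _.
  apply: leq_trans (size_scale_leq _ _) _.
  by rewrite size_divp ?polyXsubC_eq0 // size_XsubC size_D_rs /= subn1.
apply: max_poly_roots => //; apply/allP => b brs; apply/rootP.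
rewrite /P hornerD hornerN horner_sum (bigD1_seq b) //=.
rewrite big1_seq; last first.
  by move=> a /andP[ab ars]; rewrite hornerZ (cofactor_eq0 ars brs ab) mulr0.
rewrite addr0 hornerZ divfK ?cofactor_neq0 //.
rewrite {2}(divp_eq N D) hornerD hornerM.
by move: brs; rewrite -root_rs => /rootP ->; rewrite mulr0 add0r subrr.
Qed.

Lemma horner_partial_fractions s : D.[s] != 0 ->
  N.[s] / D.[s] =
  (N %/ D).[s] + \sum_(a <- rs) (N.[a] / (E a).[a]) * (s - a)^-1.
Proof.
move=> Ds; rewrite {1}(divp_eq N D) hornerD hornerM mulrDl mulfK //.
congr (_ + _); rewrite modp_partial_fractions horner_sum mulr_suml.
apply: eq_big_seq => a ars; rewrite hornerZ -mulrA; congr (_ * _).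
move: Ds; rewrite (cofactorE ars) hornerM hornerXsubC mulf_eq0 negb_or.
by case/andP => Es sa; rewrite invfM mulrA divff ?mul1r.
Qed.

Lemma cvg_residue a : a \in rs ->
  (s - a) * (N.[s] / D.[s]) @[s --> a^'] --> N.[a] / (E a).[a].
Proof.
move=> ars.
have near_eq : \forall s \near a^',
    N.[s] / (E a).[s] = (s - a) * (N.[s] / D.[s]).
  apply: filterS (near_dnbhs_horner_neq0 a D0) => s.
  rewrite (cofactorE ars) hornerM hornerXsubC mulf_eq0 negb_or.
  by case/andP=> Es sa; rewrite invfM [RHS]mulrC -!mulrA mulVf ?mulr1.
apply: (near_cvgr near_eq); apply: cvgM; first exact: cvg_horner_dnbhs.
by apply: cvgV; [exact: cofactor_neq0 | exact: cvg_horner_dnbhs].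
Qed.

End PartialFractions.

Lemma size_quotient N D :
  D != 0 -> (size N <= size D + 1)%N -> (size (N %/ D)%R <= 2)%N.
Proof.
move=> D0 ND; rewrite size_divp // leq_subLR; apply: leq_trans ND _.
by rewrite -[X in (X + 1)%N]prednK ?size_poly_gt0 // addSn addn1 addn2.
Qed.

(** After division with remainder, [N %% D] over [D] stays bounded at infinity and is killed by the
    factor [z]; only the degree one coefficient of the affine quotient survives. *)
Lemma cvg_infty_quotient N D c : D != 0 -> (size N <= size D + 1)%N ->
  z * (N.[z^-1] / D.[z^-1]) @[z --> (0 : C)^'] --> c ->
  (N %/ D)`_1 = c.
Proof.
move=> D0 ND lim.
apply: (cvgr_unique _ lim).
have near_eq : \forall z \near (0 : C)^',
   z ^+ 1 * ((N %/ D).[z^-1] / (1 : {poly C}).[z^-1]) +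
   z * (z ^+ 0 * ((N %% D).[z^-1] / D.[z^-1])) = z * (N.[z^-1] / D.[z^-1]).
  apply: filterS (near_infty_horner_neq0 D0) => z Dz.
  rewrite hornerC divr1 expr1 expr0 mul1r -mulrDr; congr (_ * _).
  by rewrite {3}(divp_eq N D) hornerD hornerM mulrDl mulfK.
apply: (near_cvgr near_eq).
rewrite -[X in _ --> X]addr0; apply: cvgD.
  have := @cvg_infty _ (N %/ D) 1 1 (oner_neq0 _).
  rewrite size_poly1 lead_coef1 divr1 /=; apply.
  exact: size_quotient.
have := @cvg_infty _ (N %% D) D 0 D0.
rewrite addn0 ltnW ?ltn_modp // addn0 => /(_ isT) l.
rewrite -[X in _ --> X](mul0r ((N %% D)`_((size D).-1) / lead_coef D)).
apply: (cvgM _ l); exact: (@cvg_id_dnbhs C 0).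
Qed.

Lemma lossless_Re_ge0 N D :
  D != 0 -> coprimep N D ->
  (forall s, 0 < 'Re s -> D.[s] != 0) ->
  N * para_conj D + para_conj N * D = 0 ->
  (forall a, 'Re a = 0 ->
    exists2 c, (s - a) * (N.[s] / D.[s]) @[s --> a^'] --> c & 0 <= c) ->
  (exists2 c, z * (N.[z^-1] / D.[z^-1]) @[z --> (0 : C)^'] --> c & 0 <= c) ->
  forall s, 0 < 'Re s -> 0 <= 'Re (N.[s] / D.[s]).
Proof.
move=> D0 cop Drhp skew axis [q limq q0] s s0.
(* The roots of D are thus symmetric about the imaginary axis, so none of them
   has a negative real part. *)
have D_sharp : D %| para_conj D.
  rewrite -(Gauss_dvdpr _ (etrans (coprimep_sym _ _) cop)).
  by rewrite -[_ * _]opprK (addr0_eq skew) dvdpNr dvdp_mulIr.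
have root_axis a : root D a -> 'Re a = 0.
  move=> Da; apply/eqP; apply: contraT => a0.
  have : ('Re a < 0) || (0 < 'Re a) by rewrite -real_neqr_lt ?Creal_Re ?rpred0.
  case/orP => ra; last by rewrite rootE (negPf (Drhp _ ra)) in Da.
  have := root_dvdp D_sharp Da; rewrite /root horner_para_conj conjC_eq0.
  by rewrite (negPf (Drhp _ _)) // raddfN /= Re_conj oppr_gt0.
have [rs DE] := closed_field_poly_normal D.
have rs_axis a : a \in rs -> 'Re a = 0.
  by move=> ars; apply: root_axis; rewrite (root_rs DE).
(* A finite limit of [(s - a) * (N.[s] / D.[s])] bounds the multiplicity of each root by one. *)
have rs_uniq : uniq rs.
  apply: count_mem_uniq => a; case: (boolP (a \in rs)) => [ars|/count_memPn //].
  apply/eqP; rewrite eqn_leq -has_count has_pred1 ars andbT.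
  have [c lim _] := axis a (rs_axis a ars).
  have <- : mup a D = count_mem a rs.
    by rewrite DE -mul_polyC mupMr ?rootC ?lead_coef_eq0 // mu_prod_XsubC.
  apply: (@cvg_mup_leq _ N D a c 1 D0 cop).
  by apply: cvgr_ext lim => x; rewrite expr1.
pose r a := N.[a] / (D %/ ('X - a%:P)).[a].
have r_ge0 a : a \in rs -> 0 <= r a.
  move=> ars; have [c lim c0] := axis a (rs_axis a ars).
  by rewrite /r (cvgr_unique (@cvg_residue N D rs DE rs_uniq D0 a ars) lim).
have sND : (size N <= size D + 1)%N.
  apply: (@cvg_infty_size_leq _ N D q 1 D0).
  by apply: cvgr_ext limq => x; rewrite expr1.
have Q1 := cvg_infty_quotient D0 sND limq.
have QE t : (N %/ D).[t] = (N %/ D)`_0 + q * t.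
  rewrite (@horner_coef_wide _ 2) ?big_ord_recl ?big_ord0 /=.
    by rewrite expr0 mulr1 expr1 addr0 /bump /= Q1.
  exact: size_quotient.
(* The coefficients [q] and [r a] are real, and since [a] is purely imaginary, the real part of
   [(t - a)^-1] is that of [t] over the squared modulus of [t - a]. *)
have Re_pf t : D.[t] != 0 -> 'Re (N.[t] / D.[t]) =
    'Re (N %/ D)`_0 + q * 'Re t + \sum_(a <- rs) r a * ('Re t / `|t - a| ^+ 2).
  move=> Dt; rewrite (@horner_partial_fractions N D rs DE rs_uniq D0 t Dt) QE.
  rewrite !raddfD /=.
  rewrite (ReMl (ger0_real q0)) raddf_sum /=; congr (_ + _).
  apply: eq_big_seq => a ars; rewrite (ReMl (ger0_real (r_ge0 _ ars))) ReV.
  by rewrite raddfB /= (rs_axis _ ars) subr0.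
(* Every other term of the partial fraction expansion is purely imaginary on
   the imaginary axis. *)
have Q0 : 'Re (N %/ D)`_0 = 0.
  have near_eq : \forall t \near (0 : C)^'+, D.['i * t] != 0.
    exact: near_imul_at_right (near_dnbhs_horner_neq0 0 D0).
  (* One point of the axis that avoids the roots of [D] suffices to read off the constant. *)
  have [t [Dt t0]] := filter_ex (filterI near_eq (nbhs_right_gt (0 : C))).
  have rt : 'Re ('i * t) = 0.
    by rewrite ReMil (Creal_ImP _ (gtr0_real t0)) oppr0.
  have := Re_pf _ Dt; rewrite rt mulr0 addr0 big1 ?addr0; last first.
    by move=> a _; rewrite mul0r mulr0.
  move=> <-; have := congr1 (fun p => p.['i * t]) skew.
  rewrite hornerD !hornerM !para_conj_axis // horner0 => skew_t.
  rewrite ReE fmorph_div addf_div ?conjC_eq0 //.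
  by rewrite skew_t !mul0r.
have Ds := Drhp s s0.
rewrite Re_pf // Q0 add0r addr_ge0 //; first by rewrite mulr_ge0 // ltW.
rewrite big_seq sumr_ge0 // => a ars; rewrite mulr_ge0 ?r_ge0 //.
by rewrite divr_ge0 ?exprn_ge0 // ltW.
Qed.

End Lossless.

(** * Quadratic forms of complex matrices *)

Section HermitianForms.
Variables (C : numClosedFieldType) (n : nat).
Implicit Types (M K : 'M[C]_n) (u v : 'cV[C]_n).

Definition qform v M : C := (v ^t* *m M *m v) 0 0.

Lemma qformE v M : qform v M = \sum_i \sum_j ((v i 0)^* * v j 0) * M i j.
Proof.
rewrite /qform mxE exchange_big /=; apply: eq_bigr => j _.
rewrite mxE mulr_suml; apply: eq_bigr => i _.
by rewrite !mxE mulrAC.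
Qed.

Lemma qformD v M K : qform v (M + K) = qform v M + qform v K.
Proof. by rewrite /qform mulmxDr mulmxDl mxE. Qed.

Lemma qformZ v (a : C) M : qform v (a *: M) = a * qform v M.
Proof. by rewrite /qform -scalemxAr -scalemxAl mxE. Qed.

Lemma qform0 v : qform v 0 = 0.
Proof. by rewrite /qform mulmx0 mul0mx mxE. Qed.

Lemma qformN v M : qform v (- M) = - qform v M.
Proof. by rewrite -scaleN1r qformZ mulN1r. Qed.

Lemma qform_adj v M : qform v (M ^t*) = (qform v M)^*.
Proof.
rewrite !qformE rmorph_sum exchange_big; apply: eq_bigr => i _ /=.
rewrite rmorph_sum; apply: eq_bigr => j _.
by rewrite !mxE !rmorphM /= conjCK; congr (_ * _); exact: mulrC.
Qed.

Lemma qform_conj v M :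
  qform v (map_mx Num.conj M) = (qform (map_mx Num.conj v) M)^*.
Proof.
rewrite !qformE rmorph_sum; apply: eq_bigr => i _ /=.
rewrite rmorph_sum; apply: eq_bigr => j _.
by rewrite !mxE !rmorphM /= !conjCK.
Qed.

(** Complex polarization: adding [v] and ['i *: v] to [u] gives [B u v + B v u = 0] and
    [B u v = B v u], so the sesquilinear form vanishes and with it each entry of [M]. *)
Lemma qform_eq0 M : (forall v, qform v M = 0) -> M = 0.
Proof.
move=> H; pose B (u v : 'cV[C]_n) := (u ^t* *m M *m v) 0 0.
have mxD1 (A A' : 'M[C]_1) : (A + A') 0 0 = A 0 0 + A' 0 0 by rewrite mxE.
have mxZ1 (a : C) (A : 'M[C]_1) : (a *: A) 0 0 = a * A 0 0 by rewrite mxE.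
have BE u v (t : C) :
    ((u + t *: v) ^t* *m M *m (u + t *: v)) 0 0 =
    B u u + t * B u v + t^* * B v u + t^* * t * B v v.
  have -> : (u + t *: v) ^t* = u ^t* + t^* *: v ^t*.
    by apply/matrixP => i j; rewrite !mxE rmorphD rmorphM.
  rewrite !mulmxDl !mulmxDr -!scalemxAl -!scalemxAr.
  rewrite !mxD1 !mxZ1.
  by rewrite addrA mulrA.
have B0 u v : B u v = 0.
  have uu : B u u = 0 by exact: H.
  have vv : B v v = 0 by exact: H.
  have := H (u + 1 *: v); rewrite /qform BE uu vv rmorph1 !mul1r add0r addr0 => e1.
  have := H (u + 'i *: v); rewrite /qform BE uu vv conjCi mulr0 add0r addr0 => e2.
  move/eqP: e2; rewrite mulNr -mulrBr mulf_eq0 (negPf (neq0Ci _)) subr_eq0 /=.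
  by move=> /eqP e2; move/eqP: e1; rewrite -e2 -mulr2n mulrn_eq0 => /eqP.
apply/matrixP => i j; rewrite [RHS]mxE -(B0 (delta_mx i 0) (delta_mx j 0)) /B.
have -> : (delta_mx i 0 : 'cV[C]_n) ^t* = delta_mx 0 i.
  by apply/matrixP => k l; rewrite !mxE rmorph_nat andbC.
by rewrite -rowE -colE !mxE.
Qed.

Lemma cvg_qform (T : Type) (F : set_system T) {FF : Filter F}
    (f : T -> 'M[C]_n) K v :
  f x @[x --> F] --> K -> qform v (f x) @[x --> F] --> qform v K.
Proof.
move=> /cvg_mxP fK; rewrite qformE; apply: (cvgr_ext (fun x => qformE v (f x))).
apply: cvgr_sum => i; apply: cvgr_sum => j.
by apply: cvgM; [exact: cvg_cst | exact: fK].
Qed.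

End HermitianForms.

(** * The reals inside the complex numbers, and the imaginary axis *)

Section RealEmbedding.
Variable R : realType.
Local Notation C := (Cplx R).
Implicit Types (x y w : R) (z : C).

Lemma toC_ge0 x : (0 <= toC x) = (0 <= x).
Proof. exact: complex.ler0c. Qed.

Lemma toC_gt0 x : (0 < toC x) = (0 < x).
Proof. exact: complex.ltcR. Qed.

Lemma toC_real x : toC x \is Num.real.
Proof.
rewrite realE toC_ge0 -[X in _ || X]oppr_ge0 -rmorphN toC_ge0 oppr_ge0.
exact: le_total.
Qed.

Lemma conj_toC x : (toC x)^* = toC x.
Proof. exact: conj_Creal (toC_real x). Qed.

Lemma toC_inj : injective (@toC R).
Proof. exact: fmorph_inj. Qed.

Lemma real_toC z : z \is Num.real -> exists x, z = toC x.
Proof. by move=> /(@complex.complex_realP R z)[x ->]; exists x. Qed.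

Lemma Re_imag_axis w : 'Re (imag_axis w) = 0.
Proof. by rewrite ReMil (Creal_ImP _ (toC_real w)) oppr0. Qed.

Lemma imag_axis_neq0 w : 0 < w -> imag_axis w != 0.
Proof. by move=> w0; rewrite mulf_neq0 ?neq0Ci // lt0r_neq0 // toC_gt0. Qed.

Lemma conj_imag_axis w : (imag_axis w)^* = - imag_axis w.
Proof. by rewrite rmorphM /= conjCi conj_toC mulNr. Qed.

(** The axis conditions are given at positive frequencies, so a point of the axis is sorted by the
    sign of its imaginary part. *)
Lemma imag_axisP z : 'Re z = 0 ->
  [\/ z = 0, exists2 w, 0 < w & z = imag_axis w |
             exists2 w, 0 < w & z = - imag_axis w].
Proof.
move=> z0; have [w wE] := real_toC (Creal_Im z).
have zE : z = imag_axis w by rewrite [z]Crect z0 add0r wE.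
have [w0|w0|w0] := ltrgtP w 0.
- constructor 3; exists (- w); rewrite ?oppr_gt0 //.
  by rewrite zE /imag_axis rmorphN mulrN opprK.
- by constructor 2; exists w.
- by constructor 1; rewrite zE w0 /imag_axis rmorph0 mulr0.
Qed.

(** Through it a limit at 0 in [z = s^-1] specialises to a limit along the imaginary axis as [w]
    grows. *)
Lemma cvg_inv_imag_axis : (imag_axis w)^-1 @[w --> +oo] --> (0 : C)^'.
Proof.
apply: cvg_dnbhs; last first.
  apply: filterS (nbhs_pinfty_gt (num_real (0 : R))) => w w0.
  by rewrite invr_neq0 // imag_axis_neq0.
apply/cvgrPdist_lt => e e0; have [x xE] := real_toC (gtr0_real e0).
rewrite xE toC_gt0 in e0 *.
apply: filterS2 (nbhs_pinfty_gt (num_real (0 : R)))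
  (nbhs_pinfty_gt (num_real x^-1)) => w w0 ltw.
rewrite sub0r normrN normrV ?unitfE ?imag_axis_neq0 // normrM normCi mul1r.
rewrite ger0_norm ?toC_ge0 ?ltW // -fmorphV.
rewrite -subr_gt0 -rmorphB toC_gt0 subr_gt0.
by rewrite -[x]invrK ltf_pV2 // posrE ?invr_gt0.
Qed.

End RealEmbedding.

(** * Positive semidefinite matrices through their quadratic forms *)

Section PositiveSemidefinite.
Variables (R : realType) (n : nat).
Implicit Types (M : 'M[Cplx R]_n) (v : 'cV[Cplx R]_n).

(** Nonnegativity makes the form real, so the form of [M - M ^t*] vanishes and polarization gives
    the Hermitian part of the definition. *)
Lemma psdmxP M : psdmx M <-> forall v, 0 <= qform v M.
Proof.
split=> [[_ //]|M0]; split => //.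
apply/is_hermitianmxP; rewrite expr0 scale1r; apply/eqP; rewrite -subr_eq0.
apply/eqP/qform_eq0 => v; rewrite qformD qformN qform_adj.
by rewrite conj_Creal ?subrr // ger0_real.
Qed.

Lemma psdmx0 : psdmx (0 : 'M[Cplx R]_n).
Proof. by apply/psdmxP => v; rewrite qform0. Qed.

(** The form of [M ^t* + M] is twice the real part of the form of [M]. *)
Lemma psdmx_adjD M : psdmx (M ^t* + M) <-> forall v, 0 <= 'Re (qform v M).
Proof.
split=> [/psdmxP|] H; [move=> v | apply/psdmxP => v].
  by have := H v; rewrite qformD qform_adj addrC ReE => ?; rewrite divr_ge0.
have := H v; rewrite qformD qform_adj addrC ReE.
by rewrite pmulr_lge0 // invr_gt0.
Qed.

End PositiveSemidefinite.

(** * Poles, limits and derivatives of transfer function matrices *)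

Section TransferMatrixLimits.
Variables (R : realType) (n : nat).
Local Notation C := (Cplx R).
Implicit Types (G F : tfmx R n) (a s z : C) (K : 'M[C]_n) (v : 'cV[C]_n).

Lemma tf_evalE G s i j : tf_eval G s i j = (numC (G i j)).[s] / (denC (G i j)).[s].
Proof. by rewrite mxE. Qed.

Lemma tf_pole_order_leq G a k :
  (tf_pole_order G a <= k)%N <-> forall i j, (mup a (denC (G i j)) <= k)%N.
Proof.
split=> [/bigmax_leqP H i j|H].
  by have /bigmax_leqP := H i isT; apply.
by apply/bigmax_leqP => i _; apply/bigmax_leqP => j _; exact: H.
Qed.

Lemma tf_pole_order_infty_leq G k :
  (tf_pole_order_infty G <= k)%N <->
  forall i j, (size (numC (G i j)) <= size (denC (G i j)) + k)%N.
Proof.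
split=> [/bigmax_leqP H i j|H].
  have /bigmax_leqP/(_ j isT) := H i isT.
  by rewrite leq_subLR !size_map_poly.
apply/bigmax_leqP => i _; apply/bigmax_leqP => j _.
by rewrite leq_subLR; have := H i j; rewrite !size_map_poly.
Qed.

Lemma tf_poleN G a : ~~ tf_pole G a <-> forall i j, (denC (G i j)).[a] != 0.
Proof.
rewrite /tf_pole lt0n negbK -leqn0 tf_pole_order_leq.
by split=> H i j; have := H i j; rewrite leqn0 -[_ == 0%N]negbK -lt0n -XsubC_dvd
  ?denC_neq0 // dvdp_XsubCl.
Qed.

(** Pole orders thus become statements about limits, which pass between [G] and [F] without
    computing reduced fractions. *)
Lemma tf_pole_order_cvg G a k :
  (tf_pole_order G a <= k)%N <->
  exists K, (s - a) ^+ k *: tf_eval G s @[s --> a^'] --> K.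
Proof.
rewrite tf_pole_order_leq; split=> [H|[K /cvg_mxP lim] i j].
  have lims : forall ij : 'I_n * 'I_n, exists c : C,
      (s - a) ^+ k * tf_eval G s ij.1 ij.2 @[s --> a^'] --> c.
    move=> [i j] /=.
    have [c lim] := mup_leq_cvg (numC (G i j)) (denC_neq0 _) (H i j).
    by exists c; apply: cvgr_ext lim => s; rewrite tf_evalE.
  have [K KP] := choice lims.
  exists (\matrix_(i, j) K (i, j)); apply/cvg_mxP => i j; rewrite mxE.
  by apply: cvgr_ext (KP (i, j)) => s; rewrite mxE.
apply: (@cvg_mup_leq _ (numC (G i j)) _ _ (K i j)).
- exact: denC_neq0.
- exact: coprime_numC_denC.
- by apply: cvgr_ext (lim i j) => s; rewrite mxE tf_evalE.
Qed.

Lemma tf_pole_order_cvg0 G a k :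
  (s - a) ^+ k.+1 *: tf_eval G s @[s --> a^'] --> (0 : 'M[C]_n) ->
  (tf_pole_order G a <= k)%N.
Proof.
move=> /cvg_mxP lim; apply/tf_pole_order_leq => i j.
apply: (@cvg0_mup_leq _ (numC (G i j))).
- exact: denC_neq0.
- exact: coprime_numC_denC.
- have := lim i j; rewrite mxE.
  by apply: cvgr_ext => s; rewrite mxE tf_evalE.
Qed.

Lemma tf_pole_order_infty_cvg G k :
  (tf_pole_order_infty G <= k)%N <->
  exists K, z ^+ k *: tf_eval G z^-1 @[z --> (0 : C)^'] --> K.
Proof.
rewrite tf_pole_order_infty_leq; split=> [H|[K /cvg_mxP lim] i j].
  exists (\matrix_(i, j) ((numC (G i j))`_((size (denC (G i j))).-1 + k) /
                          lead_coef (denC (G i j)))).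
  apply/cvg_mxP => i j; rewrite mxE.
  by apply: cvgr_ext (cvg_infty (denC_neq0 _) (H i j)) => s; rewrite mxE tf_evalE.
apply: (@cvg_infty_size_leq _ (numC (G i j)) _ (K i j)).
  exact: denC_neq0.
by apply: cvgr_ext (lim i j) => s; rewrite mxE tf_evalE.
Qed.

Lemma tf_pole_order_infty_cvg0 G k :
  z ^+ k.+1 *: tf_eval G z^-1 @[z --> (0 : C)^'] --> (0 : 'M[C]_n) ->
  (tf_pole_order_infty G <= k)%N.
Proof.
move=> /cvg_mxP lim; apply/tf_pole_order_infty_leq => i j.
apply: (@cvg0_infty_size_leq _ (numC (G i j))); first exact: denC_neq0.
have := lim i j; rewrite mxE.
by apply: cvgr_ext => s; rewrite mxE tf_evalE.
Qed.

Lemma near_tf_poleN G a : \forall s \near a^', ~~ tf_pole G s.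
Proof.
have : \forall s \near a^', forall ij : 'I_n * 'I_n,
    (denC (G ij.1 ij.2)).[s] != 0.
  apply: filter_forall => ij; exact: near_dnbhs_horner_neq0 (denC_neq0 _).
by apply: filterS => s H; apply/tf_poleN => i j; exact: (H (i, j)).
Qed.

Lemma near_infty_tf_poleN G : \forall z \near (0 : C)^', ~~ tf_pole G z^-1.
Proof.
have : \forall z \near (0 : C)^', forall ij : 'I_n * 'I_n,
    (denC (G ij.1 ij.2)).[z^-1] != 0.
  apply: filter_forall => ij; exact: near_infty_horner_neq0 (denC_neq0 _).
by apply: filterS => s H; apply/tf_poleN => i j; exact: (H (i, j)).
Qed.

Lemma cvg_tf_eval G a :
  ~~ tf_pole G a -> tf_eval G s @[s --> a^'] --> tf_eval G a.
Proof.
move=> /tf_poleN den0; apply/cvg_mxP => i j; rewrite tf_evalE.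
apply: (cvgr_ext (fun s => tf_evalE G s i j)).
apply: cvgM; first exact: cvg_horner_dnbhs.
by apply: cvgV; [exact: den0 | exact: cvg_horner_dnbhs].
Qed.

Lemma tf_eval_conj G s : tf_eval G s^* = map_mx Num.conj (tf_eval G s).
Proof.
have conj_horner (p : {poly R}) :
    (map_poly (@toC R) p).[s^*] = ((map_poly (@toC R) p).[s])^*.
  rewrite -horner_map -map_poly_comp; congr (_.[_]).
  by apply: eq_map_poly => x /=; rewrite conj_toC.
by apply/matrixP => i j; rewrite !mxE /rat_eval !conj_horner fmorph_div.
Qed.

(** Differentiability gives continuity, hence a finite limit at [a], which excludes a pole whatever
    value evaluation assigns there. *)
Lemma derivable_tf_evalP G a :
  (forall i j, derivable (fun s => tf_eval G s i j) a 1) <-> ~~ tf_pole G a.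
Proof.
split=> [dG|/tf_poleN den0 i j].
  suff : (tf_pole_order G a <= 0)%N by rewrite leqn0 /tf_pole lt0n negbK.
  apply/tf_pole_order_cvg; exists (tf_eval G a); apply/cvg_mxP => i j.
  apply: (@cvgr_ext _ _ _ _ (fun s => tf_eval G s i j)).
    by move=> s; rewrite mxE expr0 mul1r.
  have /derivable1_diffP/differentiable_continuous := dG i j.
  move=> cG; apply: cvg_trans cG; apply: cvg_app; exact: nbhs_dnbhs.
have der p : derivable (fun s : C => p.[s]) a 1.
  elim/poly_ind: p => [|p r ih].
    rewrite (_ : (fun s => _) = cst (0 : C)); first exact: derivable_cst.
    by apply/funext => s; rewrite horner0.
  rewrite (_ : (fun s => _) = (fun s : C => p.[s]) * id + cst r).
    apply: derivableD; last exact: derivable_cst.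
    by apply: derivableM; [exact: ih | exact: derivable_id].
  by apply/funext => s; rewrite hornerMXaddC.
rewrite (_ : (fun s => _) = (fun s => (numC (G i j)).[s]) *
                            (fun s => ((denC (G i j)).[s])^-1)).
  apply: derivableM; first exact: der.
  by apply: derivableV; [exact: den0 | exact: der].
by apply/funext => s; rewrite tf_evalE.
Qed.

(** Summing over the common denominator [d] and cancelling the gcd gives a coprime pair, as the
    scalar argument requires. Cancellation may remove poles for a particular [v], so [d] is kept to
    record those of the matrix. *)
Lemma qform_tf_eval G v : exists N D d : {poly C},
  [/\ D != 0, coprimep N D, d != 0,
      forall s, (d.[s] != 0) = ~~ tf_pole G s &
      forall s, ~~ tf_pole G s ->
        D.[s] != 0 /\ qform v (tf_eval G s) = N.[s] / D.[s]].
Proof.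
pose d := \prod_i \prod_j denC (G i j).
have d0 : d != 0.
  by apply/prodf_neq0 => i _; apply/prodf_neq0 => j _; exact: denC_neq0.
have dvd i j : denC (G i j) %| d.
  rewrite /d (bigD1 i) //= dvdp_mulr // (bigD1 j) //=; exact: dvdp_mulIl.
have dE s : (d.[s] != 0) = ~~ tf_pole G s.
  apply/idP/idP => [ds|/tf_poleN H].
    apply/tf_poleN => i j; have /dvdpP[q qE] := dvd i j.
    by move: ds; rewrite qE hornerM mulf_eq0 negb_or => /andP[].
  rewrite /d horner_prod; apply/prodf_neq0 => i _.
  by rewrite horner_prod; apply/prodf_neq0 => j _.
pose N := \sum_i \sum_j ((v i 0)^* * v j 0) *: (numC (G i j) * (d %/ denC (G i j))).
pose g := gcdp N d.
have g0 : g != 0 by rewrite gcdp_eq0 negb_and d0 orbT.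
have NE : N = (N %/ g) * g by rewrite divpK ?dvdp_gcdl.
have DE : d = (d %/ g) * g by rewrite divpK ?dvdp_gcdr.
exists (N %/ g), (d %/ g), d; split => //.
- by apply: contraNneq d0 => D0; rewrite DE D0 mul0r.
- by rewrite coprimep_div_gcd // d0 orbT.
move=> s; rewrite -dE => ds; have := ds; rewrite {1}DE hornerM mulf_eq0 negb_or.
move=> /andP[Ds gs]; split => //.
transitivity (N.[s] / d.[s]); last first.
  have Ns : N.[s] = (N %/ g).[s] * g.[s] by rewrite -hornerM -NE.
  have dsE : d.[s] = (d %/ g).[s] * g.[s] by rewrite -hornerM -DE.
  by rewrite Ns dsE -mulf_div divff // mulr1.
rewrite qformE /N horner_sum mulr_suml; apply: eq_bigr => i _.
rewrite horner_sum mulr_suml; apply: eq_bigr => j _.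
rewrite tf_evalE hornerZ hornerM -!mulrA; congr (_ * (_ * _)).
have dEij : d.[s] = (d %/ denC (G i j)).[s] * (denC (G i j)).[s].
  by rewrite -hornerM divpK.
have := ds; rewrite dEij mulf_eq0 negb_or => /andP[es ns].
by congr (_ * _); rewrite invfM mulrA divff // mul1r.
Qed.

End TransferMatrixLimits.

(** * Passing between [G] and [F]: values and poles *)

Lemma sub_div_eq (K : fieldType) (x p q c : K) : x != 0 -> q != 0 ->
  - x^-1 * (p / q - c) = (c * q - p) / (x * q).
Proof. by move=> x0 q0; field; rewrite x0 q0. Qed.

Lemma sub_mul_sub_div (K : fieldType) (x c g : K) : x != 0 ->
  g = c - x * (- x^-1 * (g - c)).
Proof. by move=> x0; field. Qed.

Lemma sub_mul_div (K : fieldType) (x p q c : K) : q != 0 ->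
  c - x * (p / q) = (c * q - x * p) / q.
Proof. by move=> q0; field. Qed.

Section Subtraction.
Variables (R : realType) (n : nat) (G : tfmx R n) (A : 'M[R]_n).
Local Notation C := (Cplx R).
Local Notation F := (- (tf_var R)^-1 *: (G - tf_const A) : tfmx R n).
Local Notation A_C := (map_mx (@toC R) A).

(** An entry [p / q] of [G] becomes [(a q - p) / (s q)] with [a] the entry of [A], perhaps not in
    lowest terms; its denominator is nonzero away from 0 and the poles of [G]. *)
Lemma tf_F_of_G (s : C) : s != 0 -> ~~ tf_pole G s ->
  ~~ tf_pole F s /\ tf_eval F s = - s^-1 *: (tf_eval G s - A_C).
Proof.
move=> s0 /tf_poleN den0.
have H i j : (denC (F i j)).[s] != 0 /\
    rat_eval (F i j) s = - s^-1 * (rat_eval (G i j) s - toC (A i j)).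
  have [d0 _ GE] := rat_numden_spec (G i j).
  have X0 : FracField.tofrac ('X : {poly R}) != 0 by rewrite tofrac_eq0 polyX_eq0.
  have dd0 : FracField.tofrac (rat_den (G i j)) != 0 by rewrite tofrac_eq0.
  have FE : F i j =
      FracField.tofrac ((A i j)%:P * rat_den (G i j) - rat_num (G i j)) /
      FracField.tofrac ('X * rat_den (G i j)).
    rewrite !mxE [in LHS]GE /tf_var !tofracM tofracB tofracM.
    exact: (@sub_div_eq {fraction {poly R}} _ _ _ _ X0 dd0).
  have evX : (map_poly (@toC R) ('X * rat_den (G i j))).[s] =
      s * (denC (G i j)).[s].
    by rewrite rmorphM hornerM /= map_polyX hornerX.
  have [|dF evF] := rat_eval_frac FE (z := s).
    by rewrite evX mulf_neq0.
  split => //; rewrite evF evX rmorphB rmorphM /= map_polyC.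
  rewrite hornerD hornerN hornerM hornerC.
  exact: (esym (@sub_div_eq C _ _ _ _ s0 (den0 i j))).
split; first by apply/tf_poleN => i j; case: (H i j).
by apply/matrixP => i j; rewrite [LHS]mxE (H i j).2 !mxE.
Qed.

(** Reading the relation as [G = A - s F] involves no division by [s], so 0 is not excluded here. *)
Lemma tf_G_of_F (s : C) : ~~ tf_pole F s ->
  ~~ tf_pole G s /\ tf_eval G s = A_C - s *: tf_eval F s.
Proof.
move=> /tf_poleN den0.
have H i j : (denC (G i j)).[s] != 0 /\
    rat_eval (G i j) s = toC (A i j) - s * rat_eval (F i j) s.
  have [d0 _ FE] := rat_numden_spec (F i j).
  have X0 : FracField.tofrac ('X : {poly R}) != 0 by rewrite tofrac_eq0 polyX_eq0.
  have dd0 : FracField.tofrac (rat_den (F i j)) != 0 by rewrite tofrac_eq0.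
  have GF : G i j = FracField.tofrac (A i j)%:P - FracField.tofrac 'X * F i j.
    by rewrite !mxE; exact: (@sub_mul_sub_div {fraction {poly R}} _ _ _ X0).
  have GE : G i j =
      FracField.tofrac ((A i j)%:P * rat_den (F i j) - 'X * rat_num (F i j)) /
      FracField.tofrac (rat_den (F i j)).
    rewrite GF [in LHS]FE tofracB !tofracM.
    exact: (@sub_mul_div {fraction {poly R}} _ _ _ _ dd0).
  have [|dG evG] := rat_eval_frac GE (z := s); first exact: den0.
  split => //; rewrite evG rmorphB !rmorphM /= map_polyC map_polyX.
  rewrite hornerD hornerN !hornerM hornerC hornerX.
  exact: (esym (@sub_mul_div C _ _ _ _ (den0 i j))).
split; first by apply/tf_poleN => i j; case: (H i j).
by apply/matrixP => i j; rewrite [LHS]mxE (H i j).2 !mxE.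
Qed.

End Subtraction.

(** * Limits of matrix-valued functions *)

Section MatrixLimits.
Variables (C : numClosedFieldType) (n : nat) (T : Type) (F : set_system T).
Context {FF : Filter F}.
Implicit Types (f g : T -> 'M[C]_n) (k : T -> C) (K L : 'M[C]_n).

Lemma cvg_mxZ k f (a : C) K : k x @[x --> F] --> a -> f x @[x --> F] --> K ->
  k x *: f x @[x --> F] --> a *: K.
Proof.
move=> ka /cvg_mxP fK; apply/cvg_mxP => i j; rewrite mxE.
apply: (@cvgr_ext _ _ _ _ (fun x => k x * f x i j)); first by move=> x; rewrite mxE.
by apply: cvgM => //; exact: fK.
Qed.

Lemma cvg_mxB f g K L : f x @[x --> F] --> K -> g x @[x --> F] --> L ->
  f x - g x @[x --> F] --> K - L.
Proof.
move=> /cvg_mxP fK /cvg_mxP gL; apply/cvg_mxP => i j; rewrite !mxE.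
apply: (@cvgr_ext _ _ _ _ (fun x => f x i j - g x i j)).
  by move=> x; rewrite !mxE.
by apply: cvgB; [exact: fK | exact: gL].
Qed.

Lemma cvg_mx_ext f g K :
  f =1 g -> g x @[x --> F] --> K -> f x @[x --> F] --> K.
Proof. by move=> /funext ->. Qed.

Lemma near_cvg_mx f g K : (\forall x \near F, g x = f x) ->
  g x @[x --> F] --> K -> f x @[x --> F] --> K.
Proof. by move=> fg gK; apply: cvg_trans gK; apply: near_eq_cvg; exact: fg. Qed.

End MatrixLimits.

Lemma cvg_mx_unique (C : numClosedFieldType) (n : nat) (T : Type)
    (F : set_system T) {FF : ProperFilter F} (f : T -> 'M[C]_n) (K L : 'M[C]_n) :
  f x @[x --> F] --> K -> f x @[x --> F] --> L -> K = L.
Proof.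
move=> /cvg_mxP fK /cvg_mxP fL; apply/matrixP => i j.
exact: cvgr_unique (fK i j) (fL i j).
Qed.

(** The scalar sector bounds apply to each quadratic form; for [m > 1] every form of [K] vanishes,
    and polarization gives [K = 0]. *)
Lemma sector_mx (C : numClosedFieldType) (n : nat) (h : C -> 'M[C]_n) (m : nat)
    (K : 'M[C]_n) :
  z ^+ m *: h z @[z --> (0 : C)^'] --> K ->
  (forall z, 0 < 'Re z -> forall v, 0 <= 'Re (qform v (h z))) ->
  (m = 1%N -> forall v, 0 <= qform v K) /\ ((1 < m)%N -> K = 0).
Proof.
move=> hK h0.
have lim v : qform v (z ^+ m *: h z) @[z --> (0 : C)^'] --> qform v K.
  exact: cvg_qform.
have sec v z : 0 < 'Re z -> 0 <= 'Re (qform v (z ^+ m *: h z) / z ^+ m).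
  move=> z0; rewrite qformZ mulrAC divff ?mul1r ?h0 // expf_neq0 //.
  by apply: contraTneq z0 => ->; rewrite raddf0 ltxx.
split=> [m1 v|m1].
  apply: (sector_simple_ge0 (lim v)) => z /(sec v).
  by rewrite [in X in _ / X]m1 expr1.
by apply: qform_eq0 => v; apply: (sector_multiple_eq0 m1 (lim v)); exact: sec.
Qed.

(** * Boundary behaviour of a matrix with nonnegative real part *)

Section RealPart.
Variables (R : realType) (n : nat) (F : tfmx R n).
Local Notation C := (Cplx R).
Hypothesis F_Re : forall z, 0 < 'Re z ->
  forall v, 0 <= 'Re (qform v (tf_eval F z)).

(** Translation by [a] preserves the right half-plane, so the sector argument applies at 0. At the
    exact pole order a vanishing leading coefficient would contradict that order, so the order is at
    most one. *)
Lemma Re_ge0_axis_residue (a : C) : 'Re a = 0 ->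
  exists2 K, (s - a) *: tf_eval F s @[s --> a^'] --> K &
    forall v, 0 <= qform v K.
Proof.
move=> a0.
have shift m K : (s - a) ^+ m *: tf_eval F s @[s --> a^'] --> K ->
    (m = 1%N -> forall v, 0 <= qform v K) /\ ((1 < m)%N -> K = 0).
  move=> lim; apply: (@sector_mx _ _ (fun z => tf_eval F (a + z))).
    apply: cvg_mx_ext (cvg_comp _ _ (@cvg_addl_dnbhs C a) lim) => z.
    by rewrite /= addrAC subrr add0r.
  by move=> z z0 v; apply: F_Re; rewrite raddfD /= a0 add0r.
have ord1 : (tf_pole_order F a <= 1)%N.
  rewrite leqNgt; apply/negP => m1.
  have /tf_pole_order_cvg[K lim] := leqnn (tf_pole_order F a).
  have K0 := (shift _ _ lim).2 m1; rewrite K0 -(ltn_predK m1) in lim.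
  have := tf_pole_order_cvg0 lim.
  by rewrite leqNgt (ltn_predK m1) leqnn.
have /tf_pole_order_cvg[K lim] := ord1.
exists K; first by apply: cvg_mx_ext lim => s; rewrite expr1.
exact: (shift _ _ lim).1.
Qed.

(** Inversion preserves the right half-plane, so the same argument applies to [tf_eval F z^-1] at
    0. *)
Lemma Re_ge0_infty_residue :
  exists2 K, z *: tf_eval F z^-1 @[z --> (0 : C)^'] --> K &
    forall v, 0 <= qform v K.
Proof.
have sec m K : z ^+ m *: tf_eval F z^-1 @[z --> (0 : C)^'] --> K ->
    (m = 1%N -> forall v, 0 <= qform v K) /\ ((1 < m)%N -> K = 0).
  move=> lim; apply: sector_mx lim _ => z z0 v; apply: F_Re.
  rewrite ReV divr_gt0 // exprn_gt0 // normr_gt0.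
  by apply: contraTneq z0 => ->; rewrite raddf0 ltxx.
have ord1 : (tf_pole_order_infty F <= 1)%N.
  rewrite leqNgt; apply/negP => m1.
  have /tf_pole_order_infty_cvg[K lim] := leqnn (tf_pole_order_infty F).
  have K0 := (sec _ _ lim).2 m1; rewrite K0 -(ltn_predK m1) in lim.
  have := tf_pole_order_infty_cvg0 lim.
  by rewrite leqNgt (ltn_predK m1) leqnn.
have /tf_pole_order_infty_cvg[K lim] := ord1.
exists K; first by apply: cvg_mx_ext lim => s; rewrite expr1.
exact: (sec _ _ lim).1.
Qed.

End RealPart.

(** * Positivity in the right half-plane from data on its boundary *)

Lemma horner_axis_eq0 (R : realType) (p : {poly Cplx R}) :
  (forall w : R, 0 < w -> p.[imag_axis w] = 0) -> p = 0.
Proof.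
move=> p0; apply/eqP/negPn/negP => pn0.
(* Any [size p] distinct points of the axis are already too many roots for a nonzero [p]. *)
pose r := [seq imag_axis (k.+1%:R : R) | k <- iota 0 (size p)].
have : (size r < size p)%N.
  apply: max_poly_roots => //.
    by apply/allP => _ /mapP[k _ ->]; apply/rootP/p0; rewrite ltr0n.
  rewrite map_inj_uniq ?iota_uniq // => k l /(mulfI (neq0Ci _))/toC_inj/eqP.
  by rewrite eqr_nat => /eqP[].
by rewrite size_map size_iota ltnn.
Qed.

(** Each quadratic form is a scalar rational function to which [lossless_Re_ge0] applies. *)
Lemma lossless_qform_Re_ge0 (R : realType) (n : nat) (F : tfmx R n) :
  (forall z, 0 < 'Re z -> ~~ tf_pole F z) ->
  (forall w : R, 0 < w -> ~~ tf_pole F (imag_axis w) ->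
    tf_eval F (imag_axis w) + (tf_eval F (imag_axis w)) ^t* = 0) ->
  (forall a, 'Re a = 0 ->
    exists2 K, (s - a) *: tf_eval F s @[s --> a^'] --> K &
      forall v, 0 <= qform v K) ->
  (exists2 K, z *: tf_eval F z^-1 @[z --> (0 : Cplx R)^'] --> K &
    forall v, 0 <= qform v K) ->
  forall z, 0 < 'Re z -> forall v, 0 <= 'Re (qform v (tf_eval F z)).
Proof.
move=> rhp skew axis [K limK K0] z z0 v.
have [N [D [d [D0 cop d0 dE NDE]]]] := qform_tf_eval F v.
have [_ ->] := NDE z (rhp z z0).
apply: (@lossless_Re_ge0 _ N D) => //.
- by move=> s s0; case: (NDE s (rhp s s0)).
(* The factor [d] makes the identity trivial at the poles of [F], where skewness is not assumed; it
   is cancelled once the product is the zero polynomial. *)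
- have : (N * para_conj D + para_conj N * D) * d = 0.
    apply: horner_axis_eq0 => w w0; rewrite hornerM.
    have [ds|] := eqVneq d.[imag_axis w] 0; first by rewrite ds mulr0.
    rewrite dE => nw; have [Dw qE] := NDE _ nw.
    have := congr1 (qform v) (skew w w0 nw).
    rewrite qformD qform0 qform_adj qE fmorph_div addf_div ?conjC_eq0 //.
    move/eqP; rewrite mulf_eq0 invr_eq0 mulf_eq0 conjC_eq0 orbb (negPf Dw) orbF.
    rewrite hornerD !hornerM !para_conj_axis ?Re_imag_axis // => /eqP ->.
    by rewrite mul0r.
  by move/eqP; rewrite mulf_eq0 (negPf d0) orbF => /eqP.
- move=> a a0; have [L lim L0] := axis a a0; exists (qform v L); last exact: L0.
  have limq : qform v ((s - a) *: tf_eval F s) @[s --> a^'] --> qform v L.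
    exact: cvg_qform.
  apply: near_cvgr limq.
  by apply: filterS (near_tf_poleN F a) => s /NDE[_ qE]; rewrite qformZ qE.
- exists (qform v K); last exact: K0.
  have limq : qform v (s *: tf_eval F s^-1) @[s --> (0 : Cplx R)^']
      --> qform v K.
    exact: cvg_qform.
  apply: near_cvgr limq.
  by apply: filterS (near_infty_tf_poleN F) => s /NDE[_ qE]; rewrite qformZ qE.
Qed.

(** * Transport of residues and the two implications *)

Section Equivalence.
Variables (R : realType) (n : nat) (G : tfmx R n) (A : 'M[R]_n).
Local Notation C := (Cplx R).
Local Notation A_C := (map_mx (@toC R) A).
Hypothesis G0 : ~~ tf_pole G 0.
Hypothesis tf_eval_zero : tf_eval G 0 = A_C.
Local Notation F := (- (tf_var R)^-1 *: (G - tf_const A) : tfmx R n).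

Lemma adj_A_C : A = A^T -> A_C ^t* = A_C.
Proof.
move=> AT; apply/matrixP => i j; rewrite !mxE conj_toC.
by rewrite [in LHS]AT mxE.
Qed.

Lemma cvg_sqr0 : z ^+ 2 @[z --> (0 : C)^'] --> (0 : C).
Proof.
have <- : 0 ^+ 2 = 0 :> C by rewrite expr0n.
by apply: cvgrX; rewrite expr0n; exact: cvg_id_dnbhs.
Qed.

(** The constant [A_C] drops out because [s - a] tends to 0, while [- s^-1] tends to [- a^-1]. *)
Lemma cvg_F_of_G (a : C) (L : 'M[C]_n) : a != 0 ->
  (s - a) *: tf_eval G s @[s --> a^'] --> L ->
  (s - a) *: tf_eval F s @[s --> a^'] --> - a^-1 *: L.
Proof.
move=> a0 lim.
have near_eq : \forall s \near a^',
    - s^-1 *: ((s - a) *: tf_eval G s - (s - a) *: A_C) = (s - a) *: tf_eval F s.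
  apply: filterS2 (near_neq0 a) (near_tf_poleN G a) => s s0 Gs.
  have [_ ->] := tf_F_of_G A s0 Gs.
  by rewrite -scalerBr !scalerA mulrC.
apply: near_cvg_mx near_eq _.
have -> : L = L - 0 *: A_C by rewrite scale0r subr0.
apply: cvg_mxZ; first by apply: cvgN; apply: cvgV => //; exact: cvg_id_dnbhs.
apply: cvg_mxB; first exact: lim.
by apply: cvg_mxZ; [exact: cvg_subr_dnbhs | exact: cvg_cst].
Qed.

Lemma cvg_G_of_F (a : C) (L : 'M[C]_n) :
  (s - a) *: tf_eval F s @[s --> a^'] --> L ->
  (s - a) *: tf_eval G s @[s --> a^'] --> - a *: L.
Proof.
move=> lim.
have near_eq : \forall s \near a^',
    (s - a) *: A_C - s *: ((s - a) *: tf_eval F s) = (s - a) *: tf_eval G s.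
  apply: filterS (near_tf_poleN F a) => s Fs.
  have [_ ->] := tf_G_of_F Fs.
  by move: (tf_eval F s) => M; rewrite scalerBr !scalerA mulrC.
apply: near_cvg_mx near_eq _.
have -> : - a *: L = 0 *: A_C - a *: L by rewrite scale0r add0r scaleNr.
apply: cvg_mxB; last by apply: cvg_mxZ; [exact: cvg_id_dnbhs | exact: lim].
by apply: cvg_mxZ; [exact: cvg_subr_dnbhs | exact: cvg_cst].
Qed.

(** At infinity the factor [- s^-1] lowers the order by one and reverses the sign: a double pole of
    [G] becomes a simple pole of [F]. *)
Lemma cvg_F_of_G_infty (L : 'M[C]_n) :
  z ^+ 2 *: tf_eval G z^-1 @[z --> (0 : C)^'] --> L ->
  z *: tf_eval F z^-1 @[z --> (0 : C)^'] --> - L.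
Proof.
move=> lim.
have near_eq : \forall z \near (0 : C)^',
    z ^+ 2 *: A_C - z ^+ 2 *: tf_eval G z^-1 = z *: tf_eval F z^-1.
  apply: filterS2 (near_neq0 (0 : C)) (near_infty_tf_poleN G) => z z0 Gz.
  have [_ ->] := tf_F_of_G A (invr_neq0 z0) Gz.
  by rewrite invrK scalerA mulrN scaleNr -scalerN opprB scalerBr.
apply: near_cvg_mx near_eq _.
have -> : - L = 0 *: A_C - L by rewrite scale0r add0r.
apply: cvg_mxB; last exact: lim.
by apply: cvg_mxZ; [exact: cvg_sqr0 | exact: cvg_cst].
Qed.

Lemma cvg_G_of_F_infty (L : 'M[C]_n) :
  z *: tf_eval F z^-1 @[z --> (0 : C)^'] --> L ->
  z ^+ 2 *: tf_eval G z^-1 @[z --> (0 : C)^'] --> - L.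
Proof.
move=> lim.
have near_eq : \forall z \near (0 : C)^',
    z ^+ 2 *: A_C - z *: tf_eval F z^-1 = z ^+ 2 *: tf_eval G z^-1.
  apply: filterS2 (near_neq0 (0 : C)) (near_infty_tf_poleN F) => z z0 Fz.
  have [_ ->] := tf_G_of_F Fz.
  by move: (tf_eval F z^-1) => M; rewrite scalerBr scalerA expr2 -mulrA mulfV // mulr1.
apply: near_cvg_mx near_eq _.
have -> : - L = 0 *: A_C - L by rewrite scale0r add0r.
apply: cvg_mxB; last exact: lim.
by apply: cvg_mxZ; [exact: cvg_sqr0 | exact: cvg_cst].
Qed.

(** [A_C] is Hermitian and [imag_axis w] purely imaginary, so the difference for [G] is
    [- imag_axis w] times the sum for [F]. *)
Lemma F_eval_axis (w : R) : 0 < w -> ~~ tf_pole F (imag_axis w) -> A = A^T ->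
  (tf_eval F (imag_axis w) + (tf_eval F (imag_axis w)) ^t* = 0) <->
  (tf_eval G (imag_axis w) - (tf_eval G (imag_axis w)) ^t* = 0).
Proof.
move=> w0 Fw AT; have [_ ->] := tf_G_of_F Fw; set M := tf_eval F _.
have -> : (A_C - imag_axis w *: M) ^t* = A_C + imag_axis w *: M ^t*.
  rewrite -[in RHS](adj_A_C AT); apply/matrixP => i j; rewrite !mxE.
  by rewrite rmorphB rmorphM /= conj_imag_axis mulNr opprK.
have -> : A_C - imag_axis w *: M - (A_C + imag_axis w *: M ^t*) =
    - imag_axis w *: (M + M ^t*).
  by rewrite scaleNr scalerDr opprD addrACA subrr add0r opprD.
split=> [->|/eqP]; first by rewrite scaler0.
by rewrite scaler_eq0 oppr_eq0 (negPf (imag_axis_neq0 w0)) => /eqP.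
Qed.

(** On the positive imaginary axis [G] is Hermitian off its poles; letting the point tend to 0 makes
    [G(0)] Hermitian, and being real it is symmetric. *)
Lemma lossless_symmetric : lossless_negative_imaginary G -> A = A^T.
Proof.
move=> [_ lossless].
have /cvg_mxP lim := cvg_comp _ _ (@cvg_imul_at_right C) (cvg_tf_eval G0).
have sym : A_C = A_C ^t*.
  rewrite -tf_eval_zero; apply/matrixP => i j; rewrite [RHS]mxE [in RHS]mxE.
  apply: (cvgr_unique (lim i j)).
  apply: near_cvgr (cvgr_conj (lim j i)).
  have nG := near_imul_at_right (near_tf_poleN G 0).
  apply: filterS2 nG (nbhs_right_gt 0) => t Gt t0.
  have [w wE] := real_toC (gtr0_real t0).
  move: t0 Gt; rewrite wE toC_gt0 => w0 Gw.
  have /eqP := lossless w w0 Gw; rewrite scaler_eq0 (negPf (neq0Ci _)) subr_eq0.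
  move=> /eqP/matrixP/(_ i j); rewrite [RHS]mxE [in RHS]mxE => e.
  exact: esym e.
apply/matrixP => i j; apply: toC_inj.
have /matrixP/(_ i j) := sym; rewrite !mxE conj_toC => ->.
by [].
Qed.

Lemma axis_residue_of_NI : negative_imaginary G -> forall a : C, 'Re a = 0 ->
  exists2 K, (s - a) *: tf_eval F s @[s --> a^'] --> K &
    forall v, 0 <= qform v K.
Proof.
move=> NI.
have pos w : 0 < w -> exists2 K : 'M[C]_n,
    (s - imag_axis w) *: tf_eval F s @[s --> (imag_axis w)^'] --> K &
    forall v, 0 <= qform v K.
  move=> w0; have a0 := imag_axis_neq0 w0.
  have [Gw|Gw] := boolP (tf_pole G (imag_axis w)).
    have [_ [K lim /psdmxP K0]] := ni_imag NI w0 Gw.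
    (* The limit [K] carries a factor ['i], so [G] has residue [K / 'i] and [F] has residue
       [K / w]. *)
    exists (- (imag_axis w)^-1 *: ('i^-1 *: K)).
      apply: (cvg_F_of_G a0).
      apply: cvg_mx_ext (cvg_mxZ (cvg_cst 'i^-1) lim) => s.
      by rewrite scalerA mulrCA mulVf ?neq0Ci // mulr1.
    move=> v; rewrite !qformZ mulrA mulr_ge0 ?K0 //.
    rewrite mulNr -invfM mulrAC -expr2 sqrCi mulN1r invrN opprK.
    by rewrite invr_ge0 toC_ge0 ltW.
  exists (- (imag_axis w)^-1 *: (0 *: tf_eval G (imag_axis w))).
    apply: (cvg_F_of_G a0); apply: cvg_mxZ; last exact: cvg_tf_eval.
    exact: cvg_subr_dnbhs.
  by move=> v; rewrite scale0r scaler0 qform0.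
move=> a /imag_axisP[->|[w w0 ->]|[w w0 ->]]; last 2 first.
- exact: pos.
(* Real coefficients make [F] commute with entrywise conjugation, so the residue at [- imag_axis w]
   is the entrywise conjugate of the one at [imag_axis w]. *)
- have [K lim K0] := pos w w0.
  exists (map_mx Num.conj K); last by move=> v; rewrite qform_conj conjC_ge0.
  have conjN : (- imag_axis w)^* = imag_axis w.
    by rewrite rmorphN /= conj_imag_axis opprK.
  have lim_conj : s^* @[s --> (- imag_axis w)^'] --> (imag_axis w)^'.
    by rewrite -[in X in _ --> X]conjN; exact: cvg_conj_dnbhs.
  have /cvg_mxP limc := cvg_comp _ _ lim_conj lim.
  apply/cvg_mxP => i j; rewrite mxE.
  apply: cvgr_ext (cvgr_conj (limc i j)) => s.
  rewrite mxE /= [in RHS]mxE tf_eval_conj [in RHS]mxE rmorphM /= conjCK.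
  have -> : (s^* - imag_axis w)^* = s - - imag_axis w.
    by rewrite [LHS]rmorphB /= conjCK conj_imag_axis.
  by [].
(* Near 0 the product [s F(s)] equals [G(0) - G(s)], which tends to 0 because [G] is regular
   there. *)
- exists 0; last by move=> v; rewrite qform0.
  have near_eq : \forall s \near (0 : C)^',
      A_C - tf_eval G s = (s - 0) *: tf_eval F s.
    apply: filterS2 (near_neq0 (0 : C)) (near_tf_poleN G 0) => s s0 Gs.
    have [_ ->] := tf_F_of_G A s0 Gs.
    by rewrite subr0 scalerA mulrN mulfV // scaleN1r opprB.
  apply: near_cvg_mx near_eq _.
  rewrite -[X in _ --> X](subrr A_C); apply: cvg_mxB; first exact: cvg_cst.
  by rewrite -tf_eval_zero; exact: cvg_tf_eval.
Qed.

Lemma infty_residue_of_NI : negative_imaginary G ->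
  exists2 K, z *: tf_eval F z^-1 @[z --> (0 : C)^'] --> K &
    forall v, 0 <= qform v K.
Proof.
move=> NI; have [Ginf|Ginf] := boolP (tf_pole_infty G).
  have [ord2 [K limK /psdmxP K0] _] := ni_infty NI Ginf.
  (* The order bound yields a full limit [L] at infinity, the definition a limit [K] along the
     imaginary axis; uniqueness identifies them. *)
  have /tf_pole_order_infty_cvg[L lim] := ord2.
  exists (- L); first exact: cvg_F_of_G_infty.
  suff <- : K = L by [].
  apply: (cvg_mx_unique limK).
  apply: cvg_mx_ext (cvg_comp _ _ (@cvg_inv_imag_axis R) lim) => w.
  by rewrite /= invrK exprVn.
have /tf_pole_order_infty_cvg[L lim] : (tf_pole_order_infty G <= 0)%N.
  by rewrite leqn0 -[_ == _]negbK -lt0n.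
(* With no pole at infinity [G] has a finite limit there, which the factor [z ^+ 2] sends to 0. *)
exists (- (0 *: L)); last by move=> v; rewrite scale0r oppr0 qform0.
apply: cvg_F_of_G_infty.
apply: (@cvg_mx_ext _ _ _ _ _ (fun z => z ^+ 2 *: (z ^+ 0 *: tf_eval G z^-1))).
  by move=> z; rewrite expr0 scale1r.
by apply: cvg_mxZ; [exact: cvg_sqr0 | exact: lim].
Qed.

Lemma lossless_PR_of_NI :
  lossless_negative_imaginary G -> lossless_positive_real F.
Proof.
move=> LNI; have AT := lossless_symmetric LNI.
have [NI lossless] := LNI.
have rhp z : 0 < 'Re z -> ~~ tf_pole F z.
  move=> z0; have zn0 : z != 0.
    by apply: contraTneq z0 => ->; rewrite raddf0 ltxx.
  by case: (tf_F_of_G A zn0 (ni_rhp NI z0)).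
have skew w : 0 < w -> ~~ tf_pole F (imag_axis w) ->
    tf_eval F (imag_axis w) + (tf_eval F (imag_axis w)) ^t* = 0.
  move=> w0 Fw; apply/(F_eval_axis w0 Fw AT).
  have [Gw _] := tf_G_of_F Fw.
  have /eqP := lossless w w0 Gw.
  by rewrite scaler_eq0 (negPf (neq0Ci _)) => /eqP.
split; last exact: skew.
split.
- by move=> i j z z0; move: i j; apply/derivable_tf_evalP; exact: rhp.
- by move=> x x0 i j; rewrite tf_eval_toC mxE toC_real.
- move=> z z0; apply/psdmx_adjD => v.
  apply: (lossless_qform_Re_ge0 rhp skew) => //.
    exact: axis_residue_of_NI.
  exact: infty_residue_of_NI.
Qed.

Lemma lossless_NI_of_PR :
  A = A^T -> lossless_positive_real F -> lossless_negative_imaginary G.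
Proof.
move=> AT [[der _ psd] lossless].
have F_Re z : 0 < 'Re z -> forall v, 0 <= 'Re (qform v (tf_eval F z)).
  by move=> z0; apply/psdmx_adjD; exact: psd.
have nlossless w : 0 < w -> ~~ tf_pole G (imag_axis w) -> ni_form G w = 0.
  move=> w0 Gw; have [Fw _] := tf_F_of_G A (imag_axis_neq0 w0) Gw.
  have /(F_eval_axis w0 Fw AT) e := lossless w w0 Fw.
  by rewrite /ni_form e scaler0.
split; last exact: nlossless.
split.
- move=> z z0; have /derivable_tf_evalP Fz : forall i j,
      derivable (fun s => tf_eval F s i j) z 1 by move=> i j; exact: der.
  by case: (tf_G_of_F Fz).
- by move=> w w0 Gw; rewrite nlossless //; exact: psdmx0.
- by rewrite (negPf G0).
- move=> w w0 _.
  have [K lim K0] := Re_ge0_axis_residue F_Re (Re_imag_axis w).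
  have limG := cvg_G_of_F lim.
  split.
    apply/tf_pole_order_cvg; exists (- imag_axis w *: K).
    by apply: cvg_mx_ext limG => s; rewrite expr1.
  (* When [F] has residue [K], that of [G] is [- imag_axis w *: K]; the factor ['i] turns it into
     [w] times [K]. *)
  exists ('i *: (- imag_axis w *: K)).
    apply: cvg_mx_ext (cvg_mxZ (cvg_cst 'i) limG) => s.
    by rewrite scalerA mulrC.
  apply/psdmxP => v; rewrite !qformZ mulrA mulr_ge0 ?K0 //.
  by rewrite mulrN mulrA -expr2 sqrCi mulN1r opprK toC_ge0 ltW.
- move=> _; have [K lim K0] := Re_ge0_infty_residue F_Re.
  have limG := cvg_G_of_F_infty lim.
  have limw : (imag_axis w ^+ 2)^-1 *: tf_eval G (imag_axis w)
      @[w --> +oo] --> - K.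
    apply: cvg_mx_ext (cvg_comp _ _ (@cvg_inv_imag_axis R) limG) => w.
    by rewrite /= invrK exprVn.
  split.
  + by apply/tf_pole_order_infty_cvg; exists (- K).
  + by exists (- K) => //; rewrite /nsdmx opprK; apply/psdmxP.
  + move=> m m3; rewrite -(scale0r (- K)).
    (* The limit for exponent 2 is multiplied by a positive power of [(imag_axis w)^-1], since
       [m - 2 >= 1], and so becomes 0. *)
    apply: (@cvg_mx_ext _ _ _ _ _ (fun w => (imag_axis w)^-1 ^+ (m - 2) *:
        ((imag_axis w ^+ 2)^-1 *: tf_eval G (imag_axis w)))).
      move=> w; rewrite scalerA exprVn -invfM -exprD subnK //; exact: ltnW.
    apply: cvg_mxZ => //.
    have <- : 0 ^+ (m - 2) = 0 :> C.
      by rewrite expr0n subn_eq0 leqNgt m3.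
    apply: cvgrX; apply: cvg_trans (@cvg_inv_imag_axis R) _; exact: nbhs_dnbhs.
Qed.

End Equivalence.

Theorem lemma7 (R : realType) (n : nat) (G : tfmx R n) (hG : ~~ tf_pole G 0) :
  lossless_negative_imaginary G <->
  (tf_evalR G 0 = (tf_evalR G 0)^T /\
   lossless_positive_real
     (- (tf_var R)^-1 *: (G - tf_const (tf_evalR G 0)) : tfmx R n)).
Proof.
have G0E : tf_eval G 0 = map_mx (@toC R) (tf_evalR G 0).
  by rewrite -(tf_eval_toC G 0) (rmorph0 (@toC R)).
split=> [LNI|[AT LPR]]; last exact: (lossless_NI_of_PR hG AT LPR).
have AT := lossless_symmetric hG G0E LNI.
by split; last exact: (lossless_PR_of_NI hG G0E LNI).
Qed.
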